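(* Let $(\Sigma,\mu)$ be a measure space with a ball-basis $\mathscr{B}$ (with constant $\mathfrak{C}_0$). Let $\mathbf{b}=(b_1,\ldots,b_m)$ be measurable functions and $\alpha\in\{0,1\}^m$, and set $\tau=\tau(\alpha):=\{i:\alpha_i\neq 0\}$. Let $T$ be a $\mathbb{B}$-valued multilinear bounded oscillation operator with respect to $\mathscr{B}$ and $r\in[1,\infty)$ such that $T$ is bounded from $L^r(\Sigma,\mu)\times\cdots\times L^r(\Sigma,\mu)$ to $L^{\frac rm,\infty}(\Sigma,\mu)$. Put $$\mathfrak{C}(T):=\mathfrak{C}_1(T)+\mathfrak{C}_2(T)+\|T\|_{L^r(\mu)\times\cdots\times L^r(\mu)\to L^{\frac rm,\infty}(\mu)}.$$ Then there is a constant $C>0$ depending only on $m,r,\mathfrak{C}_0$ such that for any $B\in\mathscr{B}$ and any $f_i\in L^r(\Sigma,\mu)$ with $\|f_i\|_{L^r(B,\mu)}^r\ge\frac12\|f_i\|_{L^r(\Sigma,\mu)}^r$, $i=1,\ldots,m$, there exist two $\frac{1}{2\mathfrak{C}_0^3}$-sparse families $\mathcal{S}_1,\mathcal{S}_2\subset\mathscr{B}$ such that for a.e. $x\in B$, $$|T(\vec f)(x)|\le C\,\mathfrak{C}(T)\big[\mathcal{A}_{\mathcal{S}_1,r}(\vec f)(x)+\mathcal{A}_{\mathcal{S}_2,r}(\vec f)(x)\big],$$ $$|[T,\mathbf{b}]_\alpha(\vec f)(x)|\le C\,\mathfrak{C}(T)\sum_{\tau_1\uplus\tau_2=\tau}\big[\mathcal{A}^{\mathbf{b},\tau_1,\tau_2}_{\mathcal{S}_1,r}(\vec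 f)(x)+\mathcal{A}^{\mathbf{b},\tau_1,\tau_2}_{\mathcal{S}_2,r}(\vec f)(x)\big],$$ where the sum is over all ordered pairs of disjoint sets $\tau_1,\tau_2$ with $\tau_1\cup\tau_2=\tau$.
   Context: Ball-basis. A family $\mathscr{B}$ of measurable subsets of a measure space $(\Sigma,\mu)$ is a ball-basis if: (B1) $0<\mu(B)<\infty$ for all $B\in\mathscr{B}$; (B2) for all $x,y\in\Sigma$ some $B\in\mathscr{B}$ contains both; (B3) for every $\varepsilon>0$ and measurable $E$ there is a finite or infinite sequence $\{B_k\}\subset\mathscr{B}$ with $\mu(E\Delta\bigcup_kB_k)<\varepsilon$; (B4) there is a universal constant $\mathfrak{C}_0\ge1$ and for each $B\in\mathscr{B}$ a set $B^*\in\mathscr{B}$ (fixed once and for all) with $\mu(B^* )\le\mathfrak{C}_0\mu(B)$, $\bigcup\{B'\in\mathscr{B}:B'\cap B\ne\emptyset,\ \mu(B')\le2\mu(B)\}\subset B^*$, and $A\subset B\Rightarrow A^*\subset B^*$. Notation. $\vec f=(f_1,\ldots,f_m)$, $\vec f\mathbf{1}_E=(f_1\mathbf{1}_E,\ldots,f_m\mathbf{1}_E)$, $\langle f\rangle_{B,r}:=(\frac1{\mu(B)}\int_B|f|^rd\mu)^{1/r}$, $\lfloor f\rfloor_{B,r}:=\sup_{B'\in\mathscr{B},\,B'\supset B}\langle f\rangle_{B',r}$. An operator $T$ is $m$-sublinear if in each entry $|T(\ldots,\lambda f_i,\ldots)|=|\lambda||T(\ldots,f_i,\ldots)|$ and $|T(\ldots,f_i+g_i,\ldots)|\le|T(\ldots,f_i,\ldots)|+|T(\ldots,g_i,\ldots)|$.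 Bounded oscillation operators. Let $\mathbb{B}$ be a Banach space. $T$ is a $\mathbb{B}$-valued multilinear bounded oscillation operator with respect to $\mathscr{B}$ and $r\in[1,\infty)$ if there are constants $\mathfrak{C}_1(T),\mathfrak{C}_2(T)\in(0,\infty)$ and a $\mathbb{B}$-valued $m$-linear operator $\mathcal{T}$ with $T(\vec f)(x)=\|\mathcal{T}(\vec f)(x)\|_{\mathbb{B}}$ for every $x\in\Sigma$ (or, when $\mathbb{B}=\mathbb{R}$, $\mathcal{T}=T$ is a real-valued $m$-linear or $m$-sublinear operator) such that: (T1) for every $B_0\in\mathscr{B}$ with $B_0^*\subsetneq\Sigma$ there is $B\in\mathscr{B}$ with $B\supsetneq B_0$ such that for all $\vec f\in L^r(\Sigma,\mu)^m$, $\sup_{x\in B_0}\|\mathcal{T}(\vec f\mathbf{1}_{B^*})(x)-\mathcal{T}(\vec f\mathbf{1}_{B_0^*})(x)\|_{\mathbb{B}}\le\mathfrak{C}_1(T)\prod_{i=1}^m\langle f_i\rangle_{B^*,r}$; (T2) for every $B\in\mathscr{B}$ and all $\vec f\in L^r(\Sigma,\mu)^m$, $\sup_{x,x'\in B}\|(\mathcal{T}(\vec f)-\mathcal{T}(\vec f\mathbf{1}_{B^*}))(x)-(\mathcal{T}(\vec f)-\mathcal{T}(\vec f\mathbf{1}_{B^*}))(x')\|_{\mathbb{B}}\le\mathfrak{C}_2(T)\prod_{i=1}^m\lfloor f_i\rfloor_{B,r}$. Commutators. Whenever it makes sense, $[T,\mathbf{b}]_\alpha(\vec f)(x):=T\big((b_1(x)-b_1)^{\alpha_1}f_1,\ldots,(b_m(x)-b_m)^{\alpha_m}f_m\big)(x)$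 (the value at $x$, with $b_i(x)$ treated as a constant). Sparse operators. $\mathcal{S}\subset\mathscr{B}$ is $\eta$-sparse, $\eta\in(0,1)$, if for each $B\in\mathcal{S}$ there is a measurable $E_B\subset B$ with $\mu(E_B)\ge\eta\mu(B)$ and the sets $\{E_B\}_{B\in\mathcal{S}}$ are pairwise disjoint. Define $\mathcal{A}_{\mathcal{S},r}(\vec f)(x):=\sum_{B\in\mathcal{S}}\prod_{i=1}^m\langle f_i\rangle_{B,r}\mathbf{1}_B(x)$ and, for disjoint $\tau_1,\tau_2\subset\{1,\ldots,m\}$, $$\mathcal{A}^{\mathbf{b},\tau_1,\tau_2}_{\mathcal{S},r}(\vec f)(x):=\sum_{B\in\mathcal{S}}\prod_{i\in\tau_1}|b_i(x)-b_{i,B}|\langle f_i\rangle_{B,r}\prod_{j\in\tau_2}\langle(b_j-b_{j,B})f_j\rangle_{B,r}\prod_{k\notin\tau_1\cup\tau_2}\langle f_k\rangle_{B,r}\,\mathbf{1}_B(x),$$ where $b_{i,B}:=\frac1{\mu(B)}\int_Bb_i\,d\mu$ (assumed to make sense). *)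

(* Defs.v *)
From HB Require Import structures.
From mathcomp Require Import all_boot all_order all_algebra.
From mathcomp Require Import all_classical all_reals all_analysis.

Set Implicit Arguments.
Unset Strict Implicit.
Unset Printing Implicit Defensive.

Import Order.TTheory GRing.Theory Num.Theory.
Import numFieldNormedType.Exports.

Local Open Scope classical_set_scope.
Local Open Scope ring_scope.

(* [star] is the choice B |-> B^*; its values outside [ball] are irrelevant. *)
Record ball_basis d (X : measurableType d) (R : realType)
    (mu : {measure set X -> \bar R}) (ball : set (set X))
    (star : set X -> set X) (C0 : R) : Prop := {
  ball_measurable : forall B, ball B -> measurable B ;
  ball_measure : forall B, ball B -> (0 < mu B < +oo)%E ;
  ball_connect : forall x y : X, exists2 B, ball B & B x /\ B y ;
  (* The index set [D] encodes "a finite or infinite sequence". *)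
  ball_dense : forall (e : R) (E : set X), 0 < e -> measurable E ->
    exists (D : set nat) (B : nat -> set X),
      (forall k, D k -> ball (B k)) /\
      (mu (E `+` \bigcup_(k in D) B k) < e%:E)%E ;
  ball_C0_ge1 : 1 <= C0 ;
  star_ball : forall B, ball B -> ball (star B) ;
  star_measure : forall B, ball B -> (mu (star B) <= C0%:E * mu B)%E ;
  star_hull : forall B, ball B ->
    \bigcup_(B' in [set B' | [/\ ball B', B' `&` B !=set0 &
                                 (mu B' <= 2%:E * mu B)%E]]) B' `<=` star B ;
  star_mono : forall A B, ball A -> ball B -> A `<=` B -> star A `<=` star B
}.

Section averages.
Context d (X : measurableType d) (R : realType).
Variables (mu : {measure set X -> \bar R}) (ball : set (set X)).

Definition avg_r (r : R) (B : set X) (f : X -> R) : \bar R :=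
  (((mu B)^-1 * \int[mu]_(x in B) (`|f x| `^ r)%:E) `^ r^-1)%E.

Definition sup_avg_r (r : R) (B : set X) (f : X -> R) : \bar R :=
  ereal_sup [set avg_r r B' f | B' in [set B' | ball B' /\ B `<=` B']].

Definition mean (B : set X) (b : X -> R) : R :=
  (fine (mu B))^-1 * \int[mu]_(x in B) b x.

End averages.

Section operators.
Context d (X : measurableType d) (R : realType) (m : nat).
Variables (mu : {measure set X -> \bar R}) (ball : set (set X)).
Variables (star : set X -> set X) (r : R).

Local Notation vfun := ('I_m -> X -> R).

Definition Lvec (f : vfun) : Prop := forall i, f i \in Lfun mu r%:E.

Definition vindic (f : vfun) (E : set X) : vfun := fun i => f i \* \1_E.

(* Operators are total functions on tuples of functions; only their values on
   tuples of L^r functions are ever constrained.  [dfwith f i g] is [f] with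
   its [i]-th entry replaced by [g]. *)
Definition multilinear (V : normedModType R) (T : vfun -> X -> V) : Prop :=
  forall (f : vfun) (i : 'I_m), Lvec f ->
    (forall (a : R) (x : X),
       T (dfwith f i (fun y => a * f i y)) x = a *: T f x) /\
    (forall g : X -> R, g \in Lfun mu r%:E -> forall x : X,
       T (dfwith f i (f i \+ g)) x = T f x + T (dfwith f i g) x).

Definition multisublinear (T : vfun -> X -> R) : Prop :=
  forall (f : vfun) (i : 'I_m), Lvec f ->
    (forall (a : R) (x : X),
       `|T (dfwith f i (fun y => a * f i y)) x| = `|a| * `|T f x|) /\
    (forall g : X -> R, g \in Lfun mu r%:E -> forall x : X,
       `|T (dfwith f i (f i \+ g)) x| <= `|T f x| + `|T (dfwith f i g) x|).

Definition oscillation_T1 (V : normedModType R) (T : vfun -> X -> V)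
    (C1 : R) : Prop :=
  forall B0, ball B0 -> star B0 `<` setT ->
    exists B, [/\ ball B, B0 `<` B &
      forall f, Lvec f ->
        (ereal_sup [set `|T (vindic f (star B)) x
                          - T (vindic f (star B0)) x|%:E | x in B0]
         <= C1%:E * \prod_(i < m) avg_r mu r (star B) (f i))%E].

Definition oscillation_T2 (V : normedModType R) (T : vfun -> X -> V)
    (C2 : R) : Prop :=
  forall B, ball B -> forall f, Lvec f ->
    (ereal_sup
       [set `|(T f x - T (vindic f (star B)) x)
              - (T f x' - T (vindic f (star B)) x')|%:E | x in B & x' in B]
     <= C2%:E * \prod_(i < m) sup_avg_r mu ball r B (f i))%E.

Variant bounded_oscillation (T : vfun -> X -> R) (C1 C2 : R) :
    completeNormedModType R -> Prop :=
| BO_banach (V : completeNormedModType R) (Tv : vfun -> X -> V) of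
    0 < C1 & 0 < C2 & multilinear Tv &
    (forall f, Lvec f -> forall x, T f x = `|Tv f x|) &
    oscillation_T1 Tv C1 & oscillation_T2 Tv C2 :
    bounded_oscillation T C1 C2 V
| BO_real of
    0 < C1 & 0 < C2 & multilinear (T : vfun -> X -> R^o) \/ multisublinear T &
    oscillation_T1 (T : vfun -> X -> R^o) C1 &
    oscillation_T2 (T : vfun -> X -> R^o) C2 :
    bounded_oscillation T C1 C2 R^o.

Definition weak_norm (p : R) (g : X -> R) : \bar R :=
  ereal_sup [set (a%:E * (mu [set x : X | (a < `|g x|)%R]) `^ p^-1)%E
            | a in [set a : R | 0 < a]].

Definition weak_bound (T : vfun -> X -> R) (c : R) : Prop :=
  0 <= c /\ forall f, Lvec f ->
    (weak_norm (r / m%:R) (T f)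
     <= c%:E * \prod_(i < m) 'N[mu]_r%:E[EFin \o f i])%E.

Definition weak_bounded (T : vfun -> X -> R) : Prop :=
  (forall f, Lvec f -> measurable_fun setT (T f)) /\ exists c, weak_bound T c.

Definition weak_opnorm (T : vfun -> X -> R) : R := inf [set c | weak_bound T c].

Definition commutator_arg (b : vfun) (alpha : 'I_m -> bool) (f : vfun) (x : X)
    : vfun :=
  fun i y => (b i x - b i y) ^+ alpha i * f i y.

Definition commutator (T : vfun -> X -> R) (b : vfun) (alpha : 'I_m -> bool)
    (f : vfun) (x : X) : R :=
  T (commutator_arg b alpha f x) x.

(* [T] being defined on tuples of L^r functions, the commutator makes sense at
   [x] when its argument is such a tuple. *)
Definition commutator_defined (b : vfun) (alpha : 'I_m -> bool) (f : vfun)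
    (x : X) : Prop :=
  Lvec (commutator_arg b alpha f x).

Definition sparse (eta : R) (S : set (set X)) : Prop :=
  S `<=` ball /\
  exists E : set X -> set X,
    (forall B, S B ->
       [/\ measurable (E B), E B `<=` B & (eta%:E * mu B <= mu (E B))%E]) /\
    trivIset S E.

Definition sparse_op (S : set (set X)) (f : vfun) (x : X) : \bar R :=
  (\esum_(B in S) ((\prod_(i < m) avg_r mu r B (f i)) * (\1_B x)%:E))%E.

Definition sparse_comm_op (b : vfun) (t1 t2 : {set 'I_m}) (S : set (set X))
    (f : vfun) (x : X) : \bar R :=
  (\esum_(B in S)
     ((\prod_(i in t1) (`|b i x - mean mu B (b i)|%:E * avg_r mu r B (f i))) *
      (\prod_(j in t2)
         avg_r mu r B (fun y => (b j y - mean mu B (b j)) * f j y)%R) *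
      (\prod_(k in ~: (t1 :|: t2)) avg_r mu r B (f k)) *
      (\1_B x)%:E))%E.

End operators.

(* Main.v *)
Require Import Defs.
From HB Require Import structures.
From mathcomp Require Import all_boot all_order all_algebra.
From mathcomp Require Import all_classical all_reals all_analysis.
From mathcomp Require Import measurable_realfun.
From mathcomp Require Import finmap ring lra.

Set Implicit Arguments.
Unset Strict Implicit.
Unset Printing Implicit Defensive.

Import Order.TTheory GRing.Theory Num.Theory.
Import numFieldNormedType.Exports.

Local Open Scope classical_set_scope.
Local Open Scope ring_scope.

(** The theorem is a stopping-time argument whose nodes are balls [Z], with data
    cut off to the triple star [D] of [Z].

    One step.  Outside an exceptional set [F], of measure at most a small
    multiple of that of [Z], the operator applied to the cut off data and the
    maximal functions of these data are bounded by the averages over [D]: this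
    is the weak type of the operator and that of the maximal function
    ([exceptional_set]).  The set [F] is covered by stars of balls [A] which it
    fills by half and which are almost maximal for this ([stopping_balls]).
    Let [Y] be much smaller than [Z], with [A] inside [star Y].  Condition (T1)
    at the double star of [Y] gives a strictly larger ball.  That ball is more
    than twice as large as [A], otherwise it would lie in [star A] and hence in
    the double star of [Y]; so half of it avoids [F].  Comparing, by (T2), a
    point [x] of the double star of [Y] with a good point of that ball bounds
    the operator at [x] with data cut off to [D] by the averages over [D], plus
    the operator at [x] with data cut off to the triple star of [Y]
    ([step_bound]).  Iterating from a root ball [Q] to a selected [Y] and so on
    bounds [T f x] by a sum of averages over a strictly decreasing chain of
    triple stars ([chain_domination]), which is finite for almost every [x].

    Sparseness.  Stopping balls of different nodes overlap without control, and
    all of them together need not be sparse.  But any [Y] as above may replace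
    [A], and it may come from another node.  Choosing the balls level by level
    in size, and skipping a stopping ball of [Z] near which there is already a
    chosen ball of intermediate size, yields a family in which each ball is
    touched only by few of the much smaller ones ([sparse_selection]).  Balls
    of the same level are disjoint, so after splitting the family according to
    the parity of the level, at least half of each ball is left when the
    smaller ones are removed ([sparse_parity]); passing to triple stars costs
    the factor [C0 ^+ 3].

    Commutators.  The argument of the commutator at [x] has the entries
    [(b i x - b i y) * f i y], that is, combinations of [f i] and of
    [(b i y - c) * f i y], where [c] is the mean of [b i] over [D], with
    coefficients depending on [x].  By sublinearity, bounds for the finitely
    many tuples formed of these functions, whose exceptional sets do not depend
    on [x], imply bounds for the commutator ([sublinear_mixed]).  Hence one
    family of balls serves the operator and all commutators.

    The root.  For the chain to start with the full data, these must have half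
    of their mass in [Q].  For [f i] and for [(b i y - c) * f i y], simultaneously
    for all constants [c], this holds for every sufficiently large ball of an
    exhaustion of the space ([root_ball]), and such a ball contains [B]. *)

(** * Countable and summable families of sets *)

Section summable_families.
Context d (X : measurableType d) (R : realType).
Implicit Types mu : {measure set X -> \bar R}.

Lemma countable_enum (T : Type) (W : set T) : countable W -> W !=set0 ->
  exists (D : set nat) (g : nat -> T), set_bij D W g.
Proof.
move=> /countable_injP[f injf] [r Wr]; exists (f @` W), ('pinv_(cst r) W f).
exact: injpinv_bij.
Qed.

Lemma countable_bigcup_measurable (T : choiceType) (W : set T)
    (F : T -> set X) :
  countable W -> (forall i, W i -> measurable (F i)) ->
  measurable (\bigcup_(i in W) F i).
Proof.
move=> cW mF; have [->|/set0P W0] := eqVneq W set0; first by rewrite bigcup_set0.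
have [D [g gb]] := countable_enum cW W0.
have [gf _ gs] := gb.
rewrite (reindex_bigcup g D W F gf gs).
by apply: bigcup_measurable => n Dn; apply: mF; exact: gf.
Qed.

Lemma measure_bigcup_esum mu (T : choiceType) (W : set T)
    (F : T -> set X) (U : set X) :
  countable W -> (forall i, W i -> measurable (F i)) -> measurable U ->
  U `<=` \bigcup_(i in W) F i ->
  (mu U <= \esum_(i in W) mu (F i))%E.
Proof.
move=> cW mF mU; have [->|/set0P W0] := eqVneq W set0.
  by rewrite bigcup_set0 subset0 => ->; rewrite measure0 esum_set0.
have [D [g gb]] := countable_enum cW W0.
have [gf _ gs] := gb.
rewrite (reindex_bigcup g D W F gf gs).
rewrite (reindex_esum D W g _ gb) esum_mkcond.
rewrite bigcup_mkcond => UF.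
rewrite -nneseries_esumT; last by move=> n; case: ifP.
apply: le_trans (measure_sigma_subadditive mu _ mU UF) _.
  move=> n; case: ifPn => // /set_mem Dn.
  by apply: mF; exact: gf.
apply: lee_nneseries => // n _; case: ifPn => //.
by rewrite measure0.
Qed.

Lemma negligible_countable_bigcup mu (T : choiceType) (W : set T)
    (F : T -> set X) :
  countable W -> (forall i, W i -> mu.-negligible (F i)) ->
  mu.-negligible (\bigcup_(i in W) F i).
Proof.
move=> cW nF; have [->|/set0P W0] := eqVneq W set0.
  by rewrite bigcup_set0; exact: negligible_set0.
have [D [g gb]] := countable_enum cW W0; have [gf _ gs] := gb.
rewrite (reindex_bigcup g D W F gf gs) bigcup_mkcond.
apply: negligible_bigcup => n; case: ifPn => [/set_mem/gf/nF//|_].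
exact: negligible_set0.
Qed.

(** Only finitely many terms of a summable family exceed [1 / (n + 1)]. *)
Lemma countable_of_esum (T : choiceType) (W : set T) (a : T -> \bar R) :
  (forall i, W i -> 0 < a i)%E -> (\esum_(i in W) a i < +oo)%E -> countable W.
Proof.
move=> a0 suma.
have -> : W = \bigcup_n [set i | W i /\ (n.+1%:R^-1%:E <= a i)%E].
  apply/seteqP; split=> [i Wi|i [n _ []]//].
  have [ai|] := eqVneq (a i) +oo%E.
    by exists 0 => //=; split=> //; rewrite ai leey.
  have ai0 := a0 _ Wi; rewrite -ltey => aioo.
  have aiE : a i = (fine (a i))%:E.
    by rewrite fineK// fin_real// aioo (lt_trans _ ai0)// ltNyr.
  have fai0 : 0 < fine (a i) by rewrite -lte_fin -aiE.
  exists (Num.truncn (fine (a i))^-1) => //=; split=> //.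
  rewrite aiE lee_fin invf_ple ?posrE//.
  by rewrite ltW// truncnS_gt.
apply: bigcup_countable => // n _; apply: finite_set_countable.
apply: contrapT => inf.
have suma0 : (0 <= \esum_(i in W) a i)%E by apply: esum_ge0 => i /a0/ltW.
pose K := fine (\esum_(i in W) a i).
have KE : (\esum_(i in W) a i)%E = K%:E.
  by rewrite fineK// ge0_fin_numE.
have K0 : 0 <= K by rewrite -lee_fin -KE.
have [B BW Bn] := infinite_set_fset (Num.truncn (K * n.+1%:R)).+1 inf.
have : (K%:E < \esum_(i in W) a i)%E.
  have : (K%:E < \sum_(i <- B) (n.+1%:R^-1)%:E)%E.
    rewrite sumEFin big_const_seq count_predT iter_addr_0 lte_fin.
    rewrite -[ltRHS]mulr_natl ltr_pdivlMr//.
    by apply: lt_le_trans (truncnS_gt _) _; rewrite ler_nat.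
  move=> /lt_le_trans; apply; apply: esum_ge; exists [set` B]; first by split => // i /BW[].
  rewrite fsbig_finite//= set_fsetK big_seq [leRHS]big_seq.
  by apply: lee_sum => i /BW[].
by rewrite KE ltxx.
Qed.

Lemma esum_trivIset_le mu (W : set (set X)) (U : set X) :
  (forall A, W A -> measurable A) -> trivIset W id -> measurable U ->
  (forall A, W A -> A `<=` U) -> (\esum_(A in W) mu A <= mu U)%E.
Proof.
move=> mW tW mU WU; apply: ge_ereal_sup => _ [Y [finY YW] <-].
rewrite -(@measure_fin_bigcup _ _ _ mu _ Y id)//.
- apply: le_measure; [apply/mem_set|exact/mem_set|].
    exact: (fin_bigcup_measurable finY (fun A YA => mW A (YW A YA))).
  by move=> x [A /YW/WU]; apply.
- exact: sub_trivIset tW.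
- by move=> A /YW/mW.
Qed.

Lemma esum_subset (T : choiceType) (I J : set T) (a : T -> \bar R) :
  I `<=` J -> (forall i, J i -> 0 <= a i)%E ->
  (\esum_(i in I) a i <= \esum_(i in J) a i)%E.
Proof.
move=> IJ a0; apply: ge_ereal_sup => _ [Y [finY YI] <-].
by apply: esum_ge; exists Y => //; split=> // i /YI/IJ.
Qed.

Lemma esum_ge_term (T : choiceType) (I : set T) (i : T) (a : T -> \bar R) :
  I i -> (forall j, 0 <= a j)%E -> (a i <= \esum_(j in I) a j)%E.
Proof.
move=> Ii a0; rewrite -[leLHS](@esum_set1 _ _ i a)//.
by apply: esum_subset => // _ ->.
Qed.

Lemma esumZl (T : choiceType) (I : set T) (c : R) (a : T -> \bar R) :
  0 <= c -> (forall i, I i -> 0 <= a i)%E ->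
  (\esum_(i in I) (c%:E * a i) <= c%:E * \esum_(i in I) a i)%E.
Proof.
move=> c0 a0; apply: ge_ereal_sup => _ [Y [finY YI] <-].
rewrite fsbig_finite//= big_seq -ge0_sume_distrr; last first.
  by move=> i; rewrite in_fset_set// => /set_mem/YI/a0.
rewrite -big_seq.
apply: lee_wpmul2l; first by rewrite lee_fin.
by apply: esum_ge; exists Y => //; rewrite fsbig_finite.
Qed.

End summable_families.
(** * Balls and the star operation *)

Section ball_geometry.
Context d (X : measurableType d) (R : realType).
Context (mu : {measure set X -> \bar R}) (ball : set (set X)).
Context (star : set X -> set X) (C0 : R).
Context (bb : ball_basis mu ball star C0).
Local Notation sz A := (fine (mu A)).

Lemma ball_fin_num A : ball A -> mu A \is a fin_num.
Proof.
move=> /(ball_measure bb)/andP[A0 Aoo].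
by rewrite fin_real// (lt_trans _ A0) ?ltNyr.
Qed.

Lemma ball_muE A : ball A -> mu A = (sz A)%:E.
Proof. by move=> bA; rewrite fineK// ball_fin_num. Qed.

Lemma ball_size_gt0 A : ball A -> 0 < sz A.
Proof.
move=> bA; have /andP[+ _] := ball_measure bb bA.
by rewrite (ball_muE bA) lte_fin.
Qed.

Lemma C0_gt0 : 0 < C0.
Proof. exact: lt_le_trans ltr01 (ball_C0_ge1 bb). Qed.

Lemma star_size A : ball A -> sz (star A) <= C0 * sz A.
Proof.
move=> bA; have := star_measure bb bA.
rewrite (ball_muE bA) (ball_muE (star_ball bb bA)).
by rewrite -EFinM lee_fin.
Qed.

Lemma iter_star_ball k A : ball A -> ball (iter k star A).
Proof. by move=> bA; elim: k => //= k; exact: (star_ball bb). Qed.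

Lemma iter_star_size k A : ball A -> sz (iter k star A) <= C0 ^+ k * sz A.
Proof.
move=> bA; elim: k => [|k ih] /=; first by rewrite expr0 mul1r.
rewrite (le_trans (star_size (iter_star_ball k bA)))//.
by rewrite exprS -mulrA ler_pM2l// C0_gt0.
Qed.

Lemma star_swallow A B : ball A -> ball B -> A `&` B !=set0 ->
  sz A <= 2 * sz B -> A `<=` star B.
Proof.
move=> bA bB AB AleB x Ax; apply: (star_hull bb bB); exists A => //=.
by split=> //; rewrite (ball_muE bA) (ball_muE bB) -EFinM lee_fin.
Qed.

Lemma ball_nonempty A : ball A -> A !=set0.
Proof.
move=> bA; apply/set0P/eqP => A0.
by have := ball_size_gt0 bA; rewrite A0 measure0 ltxx.
Qed.

Lemma sub_star A : ball A -> A `<=` star A.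
Proof.
move=> bA; apply: star_swallow => //; first by rewrite setIid; exact: ball_nonempty.
by rewrite ler_peMl ?ler1n// ltW// ball_size_gt0.
Qed.

Lemma sub_iter_star k A : ball A -> A `<=` iter k star A.
Proof.
move=> bA; elim: k => //= k; move/subset_trans; apply; apply: sub_star.
exact: iter_star_ball.
Qed.

Lemma ball_size_le A B : ball A -> ball B -> A `<=` B -> sz A <= sz B.
Proof.
move=> bA bB AB; rewrite -lee_fin -(ball_muE bA) -(ball_muE bB).
by apply: le_measure => //; apply/mem_set; apply: (ball_measurable bb).
Qed.

(** The factor 2 is the one tolerated by [star_hull], so a ball that is
    largest up to this factor swallows, through its star, every ball of the
    family that it meets. *)
Lemma almost_largest_ball (G : set (set X)) (K : R) :
  G `<=` ball -> G !=set0 -> (forall A, G A -> sz A <= K) ->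
  exists2 Y, G Y & forall A, G A -> sz A <= 2 * sz Y.
Proof.
move=> Gb [A0 GA0] GK; pose S := [set sz A | A in G].
have hS : has_sup S.
  by split; [exists (sz A0); exists A0 | exists K => _ [A GA <-]; exact: GK].
have supS_gt0 : 0 < sup S.
  apply: lt_le_trans (ball_size_gt0 (Gb _ GA0)) _.
  by apply: ub_le_sup; [exact: (proj2 hS) | exists A0].
have [_ [Y GY <-] hY] := @sup_adherent _ S (sup S / 2) (divr_gt0 supS_gt0 (ltr0n _ 2)) hS.
exists Y => // A GA.
have : sz A <= sup S by apply: ub_le_sup; [exact: (proj2 hS) | exists A].
by lra.
Qed.

(** Vitali's selection principle.  A maximal element is taken among the
    disjoint subfamilies that already contain, for each ball of the family
    that they touch, a touching ball at least half as large; an untouched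
    ball would allow adding an almost largest untouched one. *)
Lemma vitali_subfamily (G : set (set X)) (K : R) :
  G `<=` ball -> (forall A, G A -> sz A <= K) ->
  exists W, [/\ W `<=` G, trivIset W id &
    forall A, G A -> exists2 Y, W Y & A `&` Y !=set0 /\ sz A <= 2 * sz Y].
Proof.
move=> Gb GK.
pose P (W : set (set X)) := [/\ W `<=` G, trivIset W id &
  forall A Y, G A -> W Y -> A `&` Y !=set0 ->
    exists2 Y', W Y' & A `&` Y' !=set0 /\ sz A <= 2 * sz Y'].
have [F FP Ftot|W [[WG tW WP] Wmax]] := @Zorn_bigcup _ P.
  split.
  - by move=> A [W FW WA]; have [+ _ _] := FP _ FW; apply.
  - move=> A B [W FW WA] [W' FW' WB].
    have [WW'|W'W] := Ftot _ _ FW FW'.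
      by have [_ + _] := FP _ FW'; apply => //; exact: WW'.
    by have [_ + _] := FP _ FW; apply => //; exact: W'W.
  - move=> A Y GA [W FW WY] AY; have [_ _ /(_ A Y GA WY AY)[Y' WY' ?]] := FP _ FW.
    by exists Y' => //; exists W.
exists W; split=> // A GA.
have [[Y WY AY]|noY] := pselect (exists2 Y, W Y & A `&` Y !=set0).
  exact: WP AY.
pose G' := [set A' | G A' /\ forall Y, W Y -> ~ (A' `&` Y !=set0)].
have [||A' G'A'|Y [GY Ydisj] Ybig] := @almost_largest_ball G' K.
- by move=> A' [/Gb].
- by exists A; split=> // Y WY AY; apply: noY; exists Y.
- by case: G'A' => GA' _; exact: GK.
exfalso; apply: (Wmax (W `|` [set Y])).
  split; first exact: subsetUl.
  move=> /(_ Y (or_intror erefl)) WY; apply: (Ydisj _ WY).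
  by rewrite setIid; exact: ball_nonempty (Gb _ GY).
split.
- by move=> ? [/WG//|->].
- move=> B B' [WB|->] [WB'|->] BB' //; first exact: tW.
    by have := Ydisj _ WB; rewrite setIC => /(_ BB').
  by have := Ydisj _ WB' BB'.
- move=> B B' GB WB' BB'.
  have [[Z WZ BZ]|noZ] := pselect (exists2 Z, W Z & B `&` Z !=set0).
    by have [Z' WZ' ?] := WP _ _ GB WZ BZ; exists Z' => //; left.
  exists Y; first by right.
  case: WB' => [WB'|B'Y]; first by exfalso; apply: noZ; exists B'.
  rewrite -[Y]B'Y; split=> //; rewrite B'Y; apply: Ybig; split=> // Z WZ BZ.
  by apply: noZ; exists Z.
Qed.

End ball_geometry.
(** * Points of density and stopping balls *)

Section covering.
Context d (X : measurableType d) (R : realType).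
Context (mu : {measure set X -> \bar R}) (ball : set (set X)).
Context (star : set X -> set X) (C0 : R).
Context (bb : ball_basis mu ball star C0).
Local Notation sz A := (fine (mu A)).

Lemma negligible_small (N : set X) :
  (forall e : R, 0 < e ->
    exists2 U, measurable U & N `<=` U /\ (mu U <= e%:E)%E) ->
  mu.-negligible N.
Proof.
move=> small; pose e n : R := n.+1%:R^-1.
have e0 n : 0 < e n by rewrite invr_gt0.
have [U UP] := choice (fun n => let: ex_intro2 U m H :=
  small (e n) (e0 n) in ex_intro _ U (conj m H)).
exists (\bigcap_n U n); split.
- by apply: bigcapT_measurable => n; case: (UP n).
- apply/eqP; rewrite eq_le measure_ge0 andbT; apply/lee_addgt0Pr => a a0.
  rewrite add0e; have [mU [_ muU]] := UP (Num.truncn a^-1).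
  apply: le_trans (_ : (_ <= mu (U (Num.truncn a^-1)))%E) _.
    apply: le_measure; last exact: bigcap_inf.
      by apply/mem_set/bigcapT_measurable => n; case: (UP n).
    exact/mem_set.
  apply: le_trans muU _; rewrite lee_fin /e invf_ple ?posrE//.
  by rewrite ltW// truncnS_gt.
- by move=> x Nx n _; have [_ [+ _]] := UP n; exact.
Qed.

Lemma esum_restr_trivIset_le (W : set (set X)) (F : set X) :
  (forall A, W A -> measurable A) -> trivIset W id -> measurable F ->
  (\esum_(A in W) mu (A `&` F) <= mu F)%E.
Proof.
move=> mW tW mF.
have -> : mu F = mrestr mu mF setT by rewrite /mrestr setTI.
exact: (@esum_trivIset_le _ _ _ (mrestr mu mF) W setT mW tW measurableT).
Qed.

Lemma measure_starcover (W : set (set X)) :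
  W `<=` ball -> countable W ->
  (mu (\bigcup_(A in W) star A) <= C0%:E * \esum_(A in W) mu A)%E.
Proof.
move=> Wb cW; have mS A : W A -> measurable (star A).
  by move=> WA; exact: (ball_measurable bb (star_ball bb (Wb _ WA))).
apply: le_trans (_ : (_ <= \esum_(A in W) mu (star A))%E) _.
  apply: measure_bigcup_esum => //.
  exact: countable_bigcup_measurable.
apply: le_trans (_ : (_ <= \esum_(A in W) (C0%:E * mu A))%E) _.
  by apply: le_esum => A /Wb bA; exact: (star_measure bb).
by apply: esumZl => //; exact: ltW (C0_gt0 bb).
Qed.

(** Points of density.  Approximate [F] by a union of balls up to [e]; the
    balls containing a bad point have at least half of their mass in the
    symmetric difference, so the stars of a Vitali subfamily cover the bad
    points with total mass [O(e)]. *)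
Lemma ae_in_dense_ball (F : set X) : measurable F ->
  mu.-negligible [set x | F x /\
    ~ exists2 A, ball A & A x /\ (mu A < 2%:E * mu (A `&` F))%E].
Proof.
move=> mF; set N := [set x | _]; apply: negligible_small => e e0.
have C0p := C0_gt0 bb.
have c0 : 0 < 1 + 2 * C0 by lra.
pose e' := e / (1 + 2 * C0).
have e'0 : 0 < e' by rewrite divr_gt0.
have [D [B [Bb]]] := ball_dense bb e'0 mF.
set V := \bigcup_(k in D) B k => FV.
have mV : measurable V.
  by apply: bigcup_measurable => k Dk; exact: (ball_measurable bb (Bb _ Dk)).
pose G := [set A | exists2 k, D k & A = B k /\ exists2 x, N x & A x].
have Gb : G `<=` ball by move=> _ [k Dk [-> _]]; exact: Bb.
have mG A : G A -> measurable A by move=> /Gb; exact: (ball_measurable bb).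
have Gout A : G A -> (mu A <= 2%:E * mu (A `&` (V `\` F)))%E.
  move=> GA; have [k Dk [AB [x [Fx noA] Ax]]] := GA.
  have bA := Gb _ GA; have mA := mG _ GA.
  have : ~~ (mu A < 2%:E * mu (A `&` F))%E.
    by apply/negP => HA; apply: noA; exists A.
  rewrite -leNgt => HA.
  have AE : mu A = (mu (A `&` F) + mu (A `&` (V `\` F)))%E.
    rewrite -measureU//; first last.
    - by apply/seteqP; split=> // y [[_ Fy] [_ [_]]].
    - by apply: measurableI => //; exact: measurableD.
    - exact: measurableI.
    congr (mu _); apply/seteqP; split=> [y Ay|y [[]|[]]//].
    have [Fy|Fy] := pselect (F y); [by left|right; split=> //; split=> //].
    by exists k => //; rewrite -AB.
  have fA := ball_fin_num bb bA.
  have f1 : mu (A `&` F) \is a fin_num.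
    rewrite ge0_fin_numE//; apply: le_lt_trans (_ : (mu A < +oo)%E).
      by rewrite AE leeDl.
    by rewrite -ge0_fin_numE.
  have f2 : mu (A `&` (V `\` F)) \is a fin_num.
    rewrite ge0_fin_numE//; apply: le_lt_trans (_ : (mu A < +oo)%E).
      by rewrite AE leeDr.
    by rewrite -ge0_fin_numE.
  move: HA AE; rewrite -(fineK fA) -(fineK f1) -(fineK f2) -!EFinM lee_fin.
  by rewrite -EFinD => HA [AE]; rewrite lee_fin; lra.
have mVF : measurable (V `\` F) by exact: measurableD.
have VFe : (mu (V `\` F) <= e'%:E)%E.
  apply: le_trans (ltW FV); apply: le_measure.
  - exact/mem_set.
  - by apply/mem_set; apply: measurableU; exact: measurableD.
  - by move=> y [Vy Fy]; right.
have FVe : (mu (F `\` V) <= e'%:E)%E.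
  apply: le_trans (ltW FV); apply: le_measure.
  - by apply/mem_set; exact: measurableD.
  - by apply/mem_set; apply: measurableU; exact: measurableD.
  - by move=> y [Vy Fy]; left.
have [A GA|W [WG tW Wcov]] := @vitali_subfamily _ _ _ _ _ _ _ bb G (2 * e') Gb.
  rewrite -lee_fin -(ball_muE bb (Gb _ GA)); apply: le_trans (Gout _ GA) _.
  rewrite EFinM lee_pmul2l//; apply: le_trans VFe.
  apply: le_measure; [| exact/mem_set |exact: subIsetr].
  by apply/mem_set/measurableI => //; exact: mG.
have cW : countable W.
  have : countable (\bigcup_(k in D) [set B k]) by exact: bigcup_countable.
  apply: sub_countable; apply: subset_card_le => A /WG[k Dk [-> _]].
  by exists k.
have Wb : W `<=` ball by move=> A /WG/Gb.
exists ((F `\` V) `|` \bigcup_(A in W) star A).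
  apply: measurableU; first exact: measurableD.
  apply: countable_bigcup_measurable => // A /Wb/(star_ball bb).
  exact: (ball_measurable bb).
split.
  move=> x Nx; have [Fx _] := Nx.
  have [[k Dk Bx]|nV] := pselect (V x); last by left.
  have GBk : G (B k) by exists k => //; split=> //; exists x.
  have [Y WY [BY sY]] := Wcov _ GBk.
  right; exists Y => //.
  exact: (star_swallow bb (Bb _ Dk) (Wb _ WY) BY sY).
apply: le_trans (measureU2 _ _ _) _.
- exact: measurableD.
- apply: countable_bigcup_measurable => // A /Wb/(star_ball bb).
  exact: (ball_measurable bb).
have -> : e%:E = (e'%:E + (C0%:E * (2%:E * e'%:E)))%E.
  rewrite -!EFinM -EFinD; congr EFin.
  by rewrite /e'; field; rewrite gt_eqF.
apply: leeD => //.
apply: le_trans (measure_starcover Wb cW) _.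
apply: lee_wpmul2l; first by rewrite lee_fin ltW.
apply: le_trans (_ : (_ <= \esum_(A in W) (2%:E * mu (A `&` (V `\` F))))%E) _.
  by apply: le_esum => A /WG/Gout.
apply: le_trans (esumZl _ _) _ => //.
apply: lee_wpmul2l => //; apply: le_trans VFe.
by apply: esum_restr_trivIset_le => // A /WG/mG.
Qed.

(** A Calderon-Zygmund covering at density one half.  The balls are chosen by
    Vitali's principle among those in which [F] is dense and which are almost
    largest among the dense balls containing them; disjointness gives the bound
    on their total mass, and almost maximality the last property, by which any
    substantially larger ball contains many points outside [F]. *)
Lemma stopping_balls (F : set X) : measurable F -> (mu F < +oo)%E ->
  exists G : set (set X), [/\ G `<=` ball,
    (\esum_(A in G) mu A <= 2%:E * mu F)%E,
    mu.-negligible (F `\` \bigcup_(A in G) star A) &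
    forall A D, G A -> ball D -> A `<=` D -> 2 * sz A < sz D ->
      (2%:E * mu (D `&` F) <= mu D)%E].
Proof.
move=> mF Foo.
pose dense A := ball A /\ (mu A < 2%:E * mu (A `&` F))%E.
pose G0 := [set A | dense A /\ forall D, dense D -> A `<=` D -> sz D <= 2 * sz A].
have fF : mu F \is a fin_num by rewrite ge0_fin_numE.
have dense_le A : dense A -> sz A <= 2 * sz F.
  move=> [bA /ltW HA]; rewrite -lee_fin -(ball_muE bb bA) EFinM fineK//.
  apply: le_trans HA _; rewrite lee_pmul2l//.
  apply: le_measure; [|exact/mem_set|exact: subIsetr].
  by apply/mem_set/measurableI => //; exact: (ball_measurable bb).
have G0b : G0 `<=` ball by move=> A [[]].
have [A [/dense_le //]|G [GG0 tG Gcov]] :=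
  @vitali_subfamily _ _ _ _ _ _ _ bb G0 (2 * sz F) G0b.
have Gb : G `<=` ball by move=> A /GG0/G0b.
exists G; split=> //.
- apply: le_trans (_ : (_ <= \esum_(A in G) (2%:E * mu (A `&` F)))%E) _.
    by apply: le_esum => A /GG0[[_ /ltW]].
  apply: le_trans (esumZl _ _) _ => //.
  apply: lee_wpmul2l => //.
  by apply: esum_restr_trivIset_le => // A /Gb; exact: (ball_measurable bb).
- apply: negligibleS (ae_in_dense_ball mF) => x [Fx nx]; split=> // -[A bA [Ax HA]].
  apply: nx.
  have [||A' [dA' _]|Y [dY AY] Ymax] :=
    @almost_largest_ball _ _ _ _ _ _ _ bb [set D | dense D /\ A `<=` D] (2 * sz F).
  + by move=> D [[]].
  + by exists A; split.
  + exact: dense_le.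
  have G0Y : G0 Y.
    split=> // D dD YD; apply: Ymax; split=> //; exact: subset_trans YD.
  have [Z GZ [YZ sZ]] := Gcov _ G0Y.
  exists Z => //; apply: (star_swallow bb (G0b _ G0Y) (Gb _ GZ) YZ sZ).
  exact: AY.
- move=> A D /GG0[dA Amax] bD AD.
  by rewrite ltNge => /negP sAD; rewrite leNgt; apply/negP => HD; apply/sAD/Amax.
Qed.

(** The balls through a point, taken almost largest among those of size at
    most [n], exhaust the space after applying [star], since any two points
    lie in a common ball. *)
Lemma exhausting_balls (x0 : X) : exists G : nat -> set X,
  (forall n, ball (G n)) /\
  forall A, ball A -> A x0 -> exists n0, forall n, (n0 <= n)%N -> A `<=` G n.
Proof.
have [B0 bB0 [B0x _]] := ball_connect bb x0 x0.
have ex n : exists H, ball H /\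
    forall A, ball A -> A x0 -> sz A <= n%:R -> A `<=` star H.
  have [[A [bA Ax An]]|no] :=
    pselect (exists A, [/\ ball A, A x0 & sz A <= n%:R]); last first.
    by exists B0; split=> // A bA Ax An; exfalso; apply: no; exists A.
  have [||A' []|Y [bY Yx _] Ymax] := @almost_largest_ball _ _ _ _ _ _ _ bb
    [set A | [/\ ball A, A x0 & sz A <= n%:R]] n%:R => //.
  - by move=> ? [].
  - by exists A.
  exists Y; split=> // A' bA' A'x A'n; apply: (star_swallow bb) => //.
    by exists x0.
  by apply: Ymax.
have [H HP] := choice ex.
exists (star \o H); split=> [n|A bA Ax].
  by apply: (star_ball bb); case: (HP n).
exists (Num.truncn (sz A)).+1 => n An; have [_] := HP n; apply => //.
by apply: ltW; apply: lt_le_trans (truncnS_gt _) _; rewrite ler_nat.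
Qed.

End covering.
(** * Selection of sparse families *)

Section families_of_sets.
Context (R : realType) (T : choiceType).
Implicit Types a : T -> \bar R.

Lemma esumU_le (I J : set T) a : (forall i, 0 <= a i)%E ->
  (\esum_(i in I `|` J) a i <= \esum_(i in I) a i + \esum_(i in J) a i)%E.
Proof.
move=> a0; rewrite (esumID I)//; apply: leeD; apply: esum_subset => //.
by move=> i [[]].
Qed.

Lemma esum_bigcup_le (T' : choiceType) (D : set T') (J : T' -> set T) a :
  (forall i, 0 <= a i)%E ->
  (\esum_(i in \bigcup_(k in D) J k) a i
     <= \esum_(k in D) \esum_(i in J k) a i)%E.
Proof.
move=> a0; set U := \bigcup_(k in D) J k.
have [[k0 _]|noT'] := pselect (exists k0 : T', True); last first.
  have -> : U = set0 by apply/seteqP; split=> // i [k]; exfalso; apply: noT'; exists k.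
  by rewrite esum_set0; apply: esum_ge0 => k _; exact: esum_ge0.
have ex i : exists k, U i -> D k /\ J k i.
  have [[k Dk Jk]|nU] := pselect (U i); first by exists k.
  by exists k0.
have [p pP] := choice ex.
rewrite esum_esum//.
have -> : \esum_(i in U) a i = \esum_(k in (fun i => (p i, i)) @` U) a k.2.
  rewrite esum_image//; by move=> i j _ _ [].
apply: esum_subset => // _ [i Ui <-] /=; exact: pP.
Qed.

Lemma esum_le_levels (S : set T) (lv : T -> nat) a (c : \bar R) :
  (forall k, \esum_(i in [set i | S i /\ (lv i <= k)%N]) a i <= c)%E ->
  (\esum_(i in S) a i <= c)%E.
Proof.
move=> H; apply: ge_ereal_sup => _ [Y [finY YS] <-].
apply: le_trans (H (\sum_(i <- fset_set Y) lv i)%N).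
apply: esum_ge; exists Y => //; split=> // i Yi; split; first exact: YS.
rewrite (big_rem i)/=; last by rewrite in_fset_set// mem_set.
exact: leq_addr.
Qed.

End families_of_sets.

(** [lv s] is the integer part of the logarithm of [S / s] in base [K]: larger
    levels mean smaller sizes, two levels apart means a ratio of at least [K]. *)
Lemma geometric_levels (R : realType) (K S : R) : 1 < K -> 0 < S ->
  exists lv : R -> nat, forall s t, 0 < s <= S -> 0 < t <= S ->
    [/\ (lv s <= (lv t).+1)%N -> t <= K ^+ 2 * s,
        ((lv s).+2 <= lv t)%N -> K * t <= s &
        K ^+ 2 * t <= s -> ((lv s).+2 <= lv t)%N].
Proof.
move=> K1 S0; have K0 : 0 < K by lra.
have lnK : 0 < ln K by rewrite ln_gt0.
pose t (s : R) := ln (S / s) / ln K.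
exists (fun s => Num.truncn (t s)).
have tge0 s : 0 < s <= S -> 0 <= t s.
  move=> /andP[s0 sS]; rewrite /t divr_ge0 ?(ltW lnK)//.
  by rewrite ln_ge0// ler_pdivlMr// mul1r.
have tlt s u n : 0 < s -> 0 < u -> (t s < t u + n%:R) = (u < K ^+ n * s).
  move=> s0 u0; rewrite /t ltr_pdivrMr// mulrDl divfK ?gt_eqF// mulr_natl.
  rewrite -lnXn// -lnM ?posrE ?divr_gt0 ?exprn_gt0//.
  rewrite ltr_ln ?posrE ?mulr_gt0 ?invr_gt0 ?exprn_gt0//.
  by rewrite ltr_pdivrMr// -!mulrA ltr_pMr// ltr_pdivlMl// mulr1.
move=> s u hs hu; have /andP[s0 sS] := hs; have /andP[u0 uS] := hu.
have /andP[h1 h2] := truncn_itv (tge0 _ hs).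
have /andP[h3 h4] := truncn_itv (tge0 _ hu).
split.
- rewrite -(ler_nat R) => h; apply: ltW; rewrite -tlt//.
  by move: h h2; rewrite -!natr1; lra.
- rewrite -(ler_nat R) => h; rewrite leNgt -[K in K * _]expr1 -tlt// -leNgt.
  by move: h h2; rewrite -!natr1; lra.
- rewrite leNgt -tlt// -leNgt => h; rewrite ltnNge; apply/negP.
  by rewrite -(ler_nat R) -natr1; move: h h1 h4; rewrite -!natr1; lra.
Qed.
Section sparse_selection.
Context d (X : measurableType d) (R : realType).
Context (mu : {measure set X -> \bar R}) (ball : set (set X)).
Context (star : set X -> set X) (C0 : R).
Context (bb : ball_basis mu ball star C0).
Local Notation sz A := (fine (mu A)).
Local Notation star3 := (iter 3 star).

(** [ch Z] stands for the stopping balls of [Z].  Those of different balls may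
    overlap without control, so the tree that they generate need not be sparse.
    But a stopping ball [A] of [Z] can be replaced by any ball [Y] with [A]
    inside [star Y] that is still much smaller than [Z], and this freedom is
    used to thin out the tree.  Levels of size are treated in decreasing order
    of size.  At each level the candidates are the stopping balls of balls
    selected before, except the stopping balls of [Z] near which some ball
    has been selected at an intermediate level: that ball replaces them.
    Vitali's principle makes the selection disjoint within the level.

    Consequently, if a selected ball [A] of much larger level comes near a
    selected ball [Y], then the ball [Z] of which [A] is a stopping ball has
    level at least that of [Y] minus one, for otherwise [Y] would have replaced
    [A]; and [Z] is near [Y] too, its triple star containing that of [A].  So
    the balls near [Y] descend from those whose level differs by at most one
    from that of [Y].  The latter are disjoint within each level and lie in a
    bounded dilate of [Y], and the mass decreases geometrically along
    descents. *)
Lemma sparse_selection (Q : set X) (ch : set X -> set (set X)) :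
  ball Q -> (forall Z, ball Z -> ch Z `<=` ball) ->
  (forall Z, ball Z ->
    \esum_(A in ch Z) mu A <= (48 * C0 ^+ 11)^-1%:E * mu Z)%E ->
  (forall Z A, ball Z -> ch Z A -> star3 A `<=` star3 Z) ->
  exists (S : set (set X)) (lv : set X -> nat),
  [/\ [/\ S `<=` ball, S Q & forall Z, S Z -> sz Z <= sz Q],
      forall Z A, S Z -> ch Z A -> exists Y,
        [/\ S Y, A `<=` star Y, ((lv Z).+2 <= lv Y)%N &
            2 * C0 ^+ 3 * sz Y <= sz Z],
      forall Y Y', S Y -> S Y' -> lv Y = lv Y' -> Y `&` Y' !=set0 -> Y = Y',
      (\esum_(A in S) mu A < +oo)%E &
      forall Y, S Y -> (\esum_(A in [set A | [/\ S A, A `&` Y !=set0 &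
         ((lv Y).+2 <= lv A)%N]]) mu A <= 2^-1%:E * mu Y)%E].
Proof.
move=> bQ chb chmu ch3.
have C1 := ball_C0_ge1 bb; have C0p := C0_gt0 bb.
have Cn n : 1 <= C0 ^+ n by exact: exprn_ege1.
(* K exceeds the loss C0 ^ 3 of a triple star; eps is small against K ^ -2,
   and against the bound C0 ^ 5 * K ^ 2 on the dilate of the ball Y below *)
set eps := (48 * C0 ^+ 11)^-1; pose K := 2 * C0 ^+ 3.
have K1 : 1 < K by rewrite /K; have := Cn 3; lra.
have K2E : K ^+ 2 = 4 * C0 ^+ 6 by rewrite /K; ring.
have eps0 : 0 < eps by rewrite invr_gt0 mulr_gt0// exprn_gt0.
have epsK : eps * K ^+ 2 <= 1.
  rewrite K2E /eps mulrC ler_pdivrMr ?mulr_gt0 ?exprn_gt0// mul1r.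
  by rewrite ler_pM ?ler_nat ?exprn_ge0 ?(ltW C0p) ?ler_weXn2l.
have eps12 : eps <= 2^-1.
  have : K ^+ 2 >= 2 by rewrite K2E; have := Cn 6; lra.
  by have h1 := epsK; move=> h2; nra.
have sQ0 := ball_size_gt0 bb bQ.
have [lvR lvP] := geometric_levels K1 sQ0.
pose lv A := lvR (sz A).
pose small A := ball A /\ sz A <= sz Q.
have lvSP A A' : small A -> small A' ->
    [/\ (lv A <= (lv A').+1)%N -> sz A' <= K ^+ 2 * sz A,
        ((lv A).+2 <= lv A')%N -> K * sz A' <= sz A &
        K ^+ 2 * sz A' <= sz A -> ((lv A).+2 <= lv A')%N].
  by move=> [bA sA] [bA' sA']; apply: lvP; rewrite (ball_size_gt0 bb).
have chsz Z A : ball Z -> ch Z A -> sz A <= eps * sz Z.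
  move=> bZ chA; have bA := chb _ bZ _ chA.
  rewrite -lee_fin EFinM -(ball_muE bb bZ) -(ball_muE bb bA).
  by apply: le_trans (chmu _ bZ); exact: (@esum_ge_term _ _ _ A (fun A => mu A)).
have chlv Z A : small Z -> ch Z A -> small A /\ ((lv Z).+2 <= lv A)%N.
  move=> sZ chA; have [bZ sZQ] := sZ.
  have h := chsz _ _ bZ chA; have bA := chb _ bZ _ chA.
  have z0 := ball_size_gt0 bb bZ; have a0 := ball_size_gt0 bb bA.
  have sA : small A by split=> //; nra.
  split=> //; have [_ _] := lvSP _ _ sZ sA; apply.
  apply: le_trans (_ : K ^+ 2 * (eps * sz Z) <= _).
    by rewrite ler_wpM2l// exprn_ge0//; lra.
  by rewrite mulrA ler_piMl ?(ltW z0)// mulrC.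
pose cand (s : set (set X)) n := [set A | small A /\ exists Z,
  [/\ s Z, ch Z A, lv A = n & ~ exists Y, [/\ s Y, ((lv Z).+2 <= lv Y)%N,
     ((lv Y).+2 <= n)%N & star3 A `&` Y !=set0]]].
have [w wP] : exists w : set (set X) -> set (set X), forall G, G `<=` small ->
    [/\ w G `<=` G, trivIset (w G) id &
    forall A, G A -> exists2 Y, w G Y & A `&` Y !=set0 /\ sz A <= 2 * sz Y].
  have ex : forall G, exists W, G `<=` small -> [/\ W `<=` G, trivIset W id &
    forall A, G A -> exists2 Y, W Y & A `&` Y !=set0 /\ sz A <= 2 * sz Y]; last first.
    by have [w wP] := choice ex; exists w.
  move=> G; have [Gs|] := pselect (G `<=` small); last by exists set0.
  have [|A GA|W WP] := @vitali_subfamily _ _ _ _ _ _ _ bb G (sz Q).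
  - by move=> A /Gs[].
  - by have [] := Gs _ GA.
  by exists W.
have cands s n : cand s n `<=` small by move=> A [].
pose st := fix st n := match n with 0%N => [set Q] |
  n'.+1 => st n' `|` w (cand (st n') n'.+1) end.
pose S := \bigcup_n st n.
have st_small n : st n `<=` small.
  elim: n => [_ ->|n ih A []]; [by []|exact: ih|].
  by have [+ _ _] := wP _ (cands (st n) n.+1) => /[apply] /cands.
have st_mono n n' : (n <= n')%N -> st n `<=` st n'.
  elim: n' => [|n' ih]; first by rewrite leqn0 => /eqP->.
  rewrite leq_eqVlt => /predU1P[->//|]; rewrite ltnS => /ih h A /h; by left.
have S_small : S `<=` small by move=> A [n _ /st_small].
have S_ball : S `<=` ball by move=> A /S_small[].
have mS A : S A -> measurable A by move=> /S_ball; exact: (ball_measurable bb).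
have SQ : S Q by exists 0%N.
have S_gen A : S A -> A <> Q ->
    exists2 n, lv A = n.+1 & w (cand (st n) n.+1) A.
  move=> [n _]; elim: n => [->//|n ih [/ih//|wA] _]; exists n => //.
  by have [+ _ _] := wP _ (cands (st n) n.+1) => /(_ _ wA)[_ [Z []]].
have S_st A n : S A -> (lv A <= n)%N -> st n A.
  move=> SA An; have [->|/eqP AQ] := eqVneq A Q; first exact: (@st_mono 0%N).
  have [k lvA wA] := S_gen _ SA AQ.
  by apply: (@st_mono k.+1); [rewrite -lvA|right].
have S_parent A : S A -> A <> Q -> exists Z, [/\ S Z, ch Z A,
    ((lv Z).+2 <= lv A)%N & forall Y, S Y -> ((lv Z).+2 <= lv Y)%N ->
      ((lv Y).+2 <= lv A)%N -> star3 A `&` Y !=set0 -> False].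
  move=> SA AQ; have [n lvA wA] := S_gen _ SA AQ.
  have [+ _ _] := wP _ (cands (st n) n.+1).
  move=> /(_ _ wA)[_ [Z [sZ chA _ noY]]]; exists Z.
  have SZ : S Z by exists n.
  split=> //; first by have [] := chlv _ _ (S_small _ SZ) chA.
  move=> Y SY ZY YA AY; apply: noY; exists Y; split=> //; last by rewrite -lvA.
  by apply: S_st => //; move: YA; rewrite lvA ltnS; exact: ltnW.
have S_level Y Y' : S Y -> S Y' -> lv Y = lv Y' -> Y `&` Y' !=set0 -> Y = Y'.
  have lvQ A : S A -> A <> Q -> lv A <> lv Q.
    move=> SA AQ; have [Z [SZ chA ZA _]] := S_parent _ SA AQ => lvAQ.
    have [sA _] := chlv _ _ (S_small _ SZ) chA.
    have [_ + _] := lvSP _ _ (S_small _ SZ) (S_small _ SQ).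
    rewrite -lvAQ => /(_ ZA) h; have [_ h'] := S_small _ SZ.
    by move: h; apply/negP; rewrite -ltNge; nra.
  move=> SY SY' lvYY' YY'.
  have [YQ|/eqP YQ] := eqVneq Y Q; have [Y'Q|/eqP Y'Q] := eqVneq Y' Q.
  - by rewrite YQ.
  - by have := lvQ _ SY' Y'Q; rewrite -lvYY' YQ.
  - by have := lvQ _ SY YQ; rewrite lvYY' Y'Q.
  - have [n lvY wY] := S_gen _ SY YQ; have [n' lvY' wY'] := S_gen _ SY' Y'Q.
    have nn' : n = n' by move: lvYY'; rewrite lvY lvY' => -[].
    rewrite -nn' in wY'.
    by have [_ + _] := wP _ (cands (st n) n.+1); apply.
exists S, lv; split=> //; first by split=> // Z /S_small[].
- move=> Z A SZ chA.
  have [sA lvZA] := chlv _ _ (S_small _ SZ) chA; have [bA _] := sA.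
  have [[Y [SY ZY YA AY]]|noY] := pselect (exists Y, [/\ S Y,
     ((lv Z).+2 <= lv Y)%N, ((lv Y).+2 <= lv A)%N & star3 A `&` Y !=set0]).
    exists Y; split=> //; last first.
      by have [_ + _] := lvSP _ _ (S_small _ SZ) (S_small _ SY); apply.
    apply: subset_trans (sub_iter_star bb 3 bA) _.
    apply: (star_swallow bb) => //; [exact: (iter_star_ball bb)|exact: S_ball|].
    apply: le_trans (iter_star_size bb 3 bA) _.
    have [_ + _] := lvSP _ _ (S_small _ SY) sA => /(_ YA).
    by have := ball_size_gt0 bb bA; have := Cn 3; rewrite /K; nra.
  have [n lvA] : exists n, lv A = n.+1 by case: (lv A) lvZA => // n; exists n.
  have candA : cand (st n) n.+1 A.
    split=> //; exists Z; split=> //.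
      by apply: S_st => //; move: lvZA; rewrite lvA ltnS; exact: ltnW.
    move=> [Y [sY ZY YA AY]]; apply: noY; exists Y; split=> //; first by exists n.
    by rewrite lvA.
  have [wc _ /(_ _ candA)[Y wY [AY sAY]]] := wP _ (cands (st n) n.+1).
  have SY : S Y by exists n.+1 => //; right.
  have lvY : lv Y = lv A by have [_ [Z' [_ _ -> _]]] := wc _ wY.
  exists Y; split=> //; first by apply: (star_swallow bb) => //; exact: S_ball.
    by rewrite lvY.
  have [_ + _] := lvSP _ _ (S_small _ SZ) (S_small _ SY); apply.
  by rewrite lvY.
- apply: le_lt_trans (_ : (_ <= 2%:E * mu Q)%E) _; last first.
    by rewrite (ball_muE bb bQ) -EFinM ltry.
  apply: (@esum_le_levels _ _ _ lv) => k; elim: k => [|k ih].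
    apply: le_trans (_ : (_ <= mu Q)%E) _; last first.
      by rewrite (ball_muE bb bQ) -EFinM lee_fin; lra.
    rewrite -[leRHS](@esum_set1 _ _ Q (fun A => mu A))//.
    apply: esum_subset => // A [SA]; rewrite leqn0 => /eqP lvA.
    apply: contrapT => /(S_gen _ SA)[n]; by rewrite lvA.
  set D := [set A | S A /\ (lv A <= k)%N].
  apply: le_trans (_ : (_ <= \esum_(A in [set Q] `|` \bigcup_(Z in D) ch Z) mu A)%E) _.
    apply: esum_subset => // A [SA lvA].
    have [->|/eqP AQ] := eqVneq A Q; [by left|right].
    have [Z [SZ chA ZA _]] := S_parent _ SA AQ.
    exists Z => //; split=> //; have := leq_trans ZA lvA; rewrite ltnS.
    exact: ltnW.
  apply: le_trans (esumU_le _ _ _) _ => //.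
  rewrite esum_set1//; apply: le_trans (leeD2l _ (esum_bigcup_le _ _ _)) _ => //.
  apply: le_trans (_ : (_ <= mu Q + eps%:E * (2%:E * mu Q))%E) _; last first.
    rewrite (ball_muE bb bQ) -!EFinM -EFinD lee_fin.
    by move: sQ0 eps12; nra.
  apply: leeD2l.
  apply: le_trans (_ : (_ <= \esum_(Z in D) (eps%:E * mu Z))%E) _.
    by apply: le_esum => Z [/S_ball bZ _]; exact: chmu.
  apply: le_trans (esumZl _ _) _ => //; first exact: ltW.
  by apply: lee_wpmul2l; [rewrite lee_fin ltW|].
- move=> Y SY; have bY := S_ball _ SY; have sY0 := ball_size_gt0 bb bY.
  pose D j := [set A | [/\ S A, star3 A `&` Y !=set0 & lv A = j]].
  pose near k := [set A | [/\ S A, star3 A `&` Y !=set0,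
                              (lv Y <= (lv A).+1)%N & (lv A < k)%N]].
  pose far k := [set A | [/\ S A, star3 A `&` Y !=set0,
                              ((lv Y).+2 <= lv A)%N & (lv A < k)%N]].
  pose c := C0 ^+ 5 * K ^+ 2.
  have c0 : 0 < c by rewrite mulr_gt0// exprn_gt0//; lra.
  have Dle j : (lv Y <= j.+1)%N -> (\esum_(A in D j) mu A <= c%:E * mu Y)%E.
    (* up to two stars, the largest among Y and the triple stars near it
       contains all of them *)
    move=> Yj; pose G := Y |` (star3 @` D j).
    have sG V : G V -> sz V <= C0 ^+ 3 * K ^+ 2 * sz Y.
      move=> [->|[A [SA _ lvA] <-]].
        have h3 := Cn 3; have hK : 1 <= K ^+ 2 by rewrite exprn_ege1// ltW.
        by rewrite ler_peMl ?(ltW sY0)//; nra.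
      apply: le_trans (iter_star_size bb 3 (S_ball _ SA)) _.
      rewrite -mulrA ler_wpM2l//; first by rewrite exprn_ge0// ltW.
      by have [+ _ _] := lvSP _ _ (S_small _ SY) (S_small _ SA); rewrite lvA; apply.
    have Gb : G `<=` ball.
      by move=> V [->//|[A [SA _ _] <-]]; exact: (iter_star_ball bb _ (S_ball _ SA)).
    have [|U GU Umax] := almost_largest_ball bb Gb _ sG; first by exists Y; left.
    have bU := Gb _ GU.
    have YU : Y `<=` star U.
      apply: (star_swallow bb) => //; last by apply: Umax; left.
      case: GU => [->|[A [_ AY _] <-]]; last by rewrite setIC.
      by rewrite setIid; exact: (ball_nonempty bb).
    have DU A : D j A -> A `<=` star (star U).
      move=> DA; have [SA [x [Ax Yx]] lvA] := DA; have bA := S_ball _ SA.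
      apply: subset_trans (sub_iter_star bb 3 bA) _.
      apply: (star_swallow bb); [exact: (iter_star_ball bb)|exact: (star_ball bb)| |].
        by exists x; split => //; exact: YU.
      apply: le_trans (Umax _ _) _; first by right; exists A.
      rewrite ler_pM2l//; apply: (ball_size_le bb) => //.
        exact: (star_ball bb).
      exact: (sub_star bb).
    have bUU : ball (star (star U)) by do 2 apply: (star_ball bb).
    apply: le_trans (_ : (_ <= mu (star (star U)))%E) _.
      apply: esum_trivIset_le => //; last exact: (ball_measurable bb).
        by move=> A [SA _ _]; exact: mS.
      by move=> A B [SA _ lvA] [SB _ lvB]; apply: S_level => //; rewrite lvA.
    rewrite (ball_muE bb bUU) (ball_muE bb bY) -EFinM lee_fin.
    apply: le_trans (iter_star_size bb 2 bU) _.
    have -> : c * sz Y = C0 ^+ 2 * (C0 ^+ 3 * K ^+ 2 * sz Y) by rewrite /c; ring.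
    by rewrite ler_wpM2l ?exprn_ge0 ?(ltW C0p)//; exact: sG.
  have farP k : (\esum_(A in near k) mu A <= (6 * c)%:E * mu Y)%E ->
      (\esum_(A in far k.+1) mu A <= 2^-1%:E * mu Y)%E.
    move=> ih.
    apply: le_trans (_ : (_ <= \esum_(A in \bigcup_(Z in near k) ch Z) mu A)%E) _.
      apply: esum_subset => // A [SA AY lvA lvAk].
      have AQ : A <> Q.
        move=> AQ; have [_ + _] := lvSP _ _ (S_small _ SY) (S_small _ SA).
        move=> /(_ lvA) h; have [_ h'] := S_small _ SY.
        by move: h; apply/negP; rewrite AQ -ltNge; nra.
      have [Z [SZ chA ZA ZP]] := S_parent _ SA AQ.
      exists Z => //; split=> //; last first.
      - exact: ltnW (leq_trans ZA (ltnSE lvAk)).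
      - rewrite leqNgt; apply/negP => ZY; apply: (ZP _ SY) => //.
      - by case: AY => x [Ax Yx]; exists x; split=> //; exact: (ch3 Z A (S_ball _ SZ)).
    apply: le_trans (esum_bigcup_le _ _ _) _ => //.
    apply: le_trans (_ : (_ <= \esum_(Z in near k) (eps%:E * mu Z))%E) _.
      by apply: le_esum => Z [/S_ball bZ _ _ _]; exact: chmu.
    apply: le_trans (esumZl _ _) _ => //; first exact: ltW.
    apply: le_trans (_ : (_ <= eps%:E * ((6 * c)%:E * mu Y))%E) _.
      by apply: lee_wpmul2l; [rewrite lee_fin ltW|].
    rewrite (ball_muE bb bY) -!EFinM lee_fin mulrA ler_wpM2r ?(ltW sY0)//.
    rewrite /c K2E /eps mulrC ler_pdivrMr ?mulr_gt0 ?exprn_gt0//.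
    by rewrite le_eqVlt; apply/orP; left; apply/eqP; field.
  have nearP k : (\esum_(A in near k) mu A <= (6 * c)%:E * mu Y)%E.
    elim: k => [|k ih].
      have -> : near 0%N = set0 by apply/seteqP; split=> // A [].
      by rewrite esum_set0 mule_ge0// lee_fin; lra.
    apply: le_trans (_ : (_ <= \esum_(A in D (lv Y).-1 `|` D (lv Y) `|`
        D (lv Y).+1 `|` far k.+1) mu A)%E) _.
      apply: esum_subset => // A [SA AY lvA lvAk].
      have [lA|] := leqP (lv Y).+2 (lv A); first by right.
      rewrite ltnS leq_eqVlt => /predU1P[lA|]; first by left; right.
      rewrite ltnS leq_eqVlt => /predU1P[lA|lA]; first by left; left; right.
      left; left; left; split=> //; apply/eqP; rewrite eqn_leq.
      by move: lvA lA; case: (lv Y) => [//|n] /=; rewrite !ltnS => h1 h2; apply/andP.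
    have -> : ((6 * c)%:E * mu Y =
        c%:E * mu Y + c%:E * mu Y + c%:E * mu Y + (3 * c)%:E * mu Y)%E.
      by rewrite (ball_muE bb bY) -!EFinM -!EFinD; congr EFin; ring.
    apply: le_trans (esumU_le _ _ _) _ => //; apply: leeD; last first.
      apply: le_trans (farP _ ih) _; rewrite (ball_muE bb bY) -!EFinM lee_fin.
      rewrite ler_wpM2r ?(ltW sY0)//.
      have := Cn 5; have : 1 <= K ^+ 2 by rewrite exprn_ege1// ltW.
      by rewrite /c; nra.
    apply: le_trans (esumU_le _ _ _) _ => //; apply: leeD.
      2: by apply: Dle; exact: leqW.
    apply: le_trans (esumU_le _ _ _) _ => //.
    by apply: leeD; apply: Dle => //; exact: leqSpred.
  apply: (@esum_le_levels _ _ _ lv) => k; apply: le_trans (farP k (nearP k)).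
  apply: esum_subset => // A [[SA [x [Ax Yx]] lvA] lvAk]; split=> //.
  exists x; split=> //; exact: (sub_iter_star bb 3 (S_ball _ SA)).
Qed.

End sparse_selection.
Section sparse_parts.
Context d (X : measurableType d) (R : realType).
Context (mu : {measure set X -> \bar R}) (ball : set (set X)).
Context (star : set X -> set X) (C0 : R).
Context (bb : ball_basis mu ball star C0).
Local Notation sz A := (fine (mu A)).
Context (S : set (set X)) (lv : set X -> nat) (Sb : S `<=` ball).
Context (muS : (\esum_(A in S) mu A < +oo)%E).

Lemma countable_summable_balls : countable S.
Proof.
by apply: (countable_of_esum _ muS) => A /Sb/(ball_measure bb)/andP[].
Qed.

Lemma ae_bounded_levels k :
  mu.-negligible [set x | forall n, exists Y,
    [/\ S Y, (n <= lv Y)%N & iter k star Y x]].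
Proof.
have C0p := C0_gt0 bb.
pose J n := [set Y | S Y /\ lv Y = n].
pose F n := \bigcup_(Y in J n) iter k star Y.
have cJ n : countable (J n).
  apply: sub_countable countable_summable_balls.
  by apply: subset_card_le => Y [].
have mY Y : S Y -> measurable (iter k star Y).
  by move=> /Sb bY; exact: (ball_measurable bb (iter_star_ball bb k bY)).
have mF n : measurable (F n).
  by apply: countable_bigcup_measurable => // Y [/mY].
have FJ n : (mu (F n) <= (C0 ^+ k)%:E * \esum_(Y in J n) mu Y)%E.
  apply: le_trans (_ : (_ <= \esum_(Y in J n) mu (iter k star Y))%E) _.
    by apply: measure_bigcup_esum => // Y [/mY].
  apply: le_trans (_ : (_ <= \esum_(Y in J n) ((C0 ^+ k)%:E * mu Y))%E) _.
    apply: le_esum => Y [/Sb bY _].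
    rewrite (ball_muE bb bY) (ball_muE bb (iter_star_ball bb k bY)) -EFinM.
    by rewrite lee_fin; exact: (iter_star_size bb).
  by apply: esumZl => //; rewrite exprn_ge0// ltW.
have SJ : \bigcup_n J n = S.
  by apply/seteqP; split=> [Y [n _ []]//|Y SY]; exists (lv Y).
have tJ : trivIset setT J.
  by move=> i j _ _ [Y [[_ <-] [_ <-]]].
have sumF : (\sum_(0 <= n <oo) mu (F n) < +oo)%E.
  have : ((C0 ^+ k)%:E * (\esum_(Y in S) mu Y) < +oo)%E.
    by rewrite lte_mul_pinfty// lee_fin exprn_ge0// ltW.
  apply: le_lt_trans; rewrite -SJ nneseries_sum_bigcup//.
  rewrite -nneseriesZl//; last by move=> n _; exact: esum_ge0.
  by apply: lee_nneseries.
have := lim_sup_set_cvg0 mF sumF => limF.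
have mlim : measurable (lim_sup_set F).
  apply: bigcapT_measurable => n; exact: bigcup_measurable.
apply: negligibleS ((negligibleP mu mlim).2 limF) => x Hx n _.
by have [Y [SY nY Yx]] := Hx n; exists (lv Y) => //; exists Y.
Qed.

Context (S_level : forall Y Y', S Y -> S Y' -> lv Y = lv Y' -> Y `&` Y' !=set0 -> Y = Y').
Context (S_carleson : forall Y, S Y ->
  (\esum_(A in [set A | [/\ S A, A `&` Y !=set0 & ((lv Y).+2 <= lv A)%N]]) mu A
    <= 2^-1%:E * mu Y)%E).

(** Balls of one level are disjoint, and those of levels of the same parity
    differ by at least two levels: removing from each ball the much smaller
    balls that touch it leaves disjoint sets of at least half its size. *)
Lemma sparse_parity (p : bool) : sparse mu ball (2 * C0 ^+ 3)^-1
  [set D | exists2 Y, S Y & odd (lv Y) = p /\ D = iter 3 star Y].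
Proof.
have C0p := C0_gt0 bb; set SP := [set D | _].
split; first by move=> D [Y /Sb bY [_ ->]]; exact: (iter_star_ball bb).
have ex D : exists Y, SP D -> [/\ S Y, odd (lv Y) = p & D = iter 3 star Y].
  have [[Y SY [pY DY]]|nSP] := pselect (SP D); first by exists Y.
  by exists set0.
have [y yP] := choice ex.
pose small Y := [set A | [/\ S A, A `&` Y !=set0 & ((lv Y).+2 <= lv A)%N]].
pose rest Y := \bigcup_(A in small Y) A.
have mS A : S A -> measurable A by move=> /Sb; exact: (ball_measurable bb).
have mrest Y : measurable (rest Y).
  apply: countable_bigcup_measurable; last by move=> A [/mS].
  apply: sub_countable countable_summable_balls.
  by apply: subset_card_le => A [].
exists (fun D => y D `\` rest (y D)); split.
  move=> D SPD; have [SY pY DY] := yP D SPD; have bY := Sb SY.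
  split.
  - by apply: measurableD => //; exact: mS.
  - by rewrite [X in _ `<=` X]DY => x [Yx _]; exact: (sub_iter_star bb).
  have restY : (mu (rest (y D)) <= 2^-1%:E * mu (y D))%E.
    apply: le_trans (S_carleson SY).
    apply: measure_bigcup_esum => //; last by move=> A [/mS].
    apply: sub_countable countable_summable_balls.
    by apply: subset_card_le => A [].
  have frest : mu (rest (y D)) \is a fin_num.
    rewrite ge0_fin_numE//; apply: le_lt_trans restY _.
    by rewrite (ball_muE bb bY) -EFinM ltry.
  have mE : measurable (y D `\` rest (y D)) by apply: measurableD => //; exact: mS.
  have le1 : (mu (y D) <= mu (y D `\` rest (y D)) + mu (rest (y D)))%E.
    apply: le_trans (measureU2 _ mE (mrest _)).
    apply: le_measure; [by apply/mem_set; exact: mS|by apply/mem_set; exact: measurableU|].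
    move=> x Yx; have [Rx|nR] := pselect (rest (y D) x); [by right|by left].
  have fE : mu (y D `\` rest (y D)) \is a fin_num.
    rewrite ge0_fin_numE//; apply: le_lt_trans (_ : (mu (y D) < +oo)%E).
      apply: le_measure; [exact/mem_set|by apply/mem_set; exact: mS|exact: subDsetl].
    by rewrite (ball_muE bb bY) ltry.
  have bD := iter_star_ball bb 3 bY; have sD := iter_star_size bb 3 bY.
  rewrite [in X in (X <= _)%E]DY (ball_muE bb bD) -(fineK fE) -EFinM lee_fin.
  move: restY le1; rewrite (ball_muE bb bY) -(fineK fE) -(fineK frest) -EFinM -EFinD.
  rewrite !lee_fin => h1 h2.
  rewrite mulrC ler_pdivrMr ?mulr_gt0 ?exprn_gt0//.
  apply: le_trans sD _.
  have c3 : 0 < C0 ^+ 3 by rewrite exprn_gt0.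
  have -> : fine (mu (y D `\` rest (y D))) * (2 * C0 ^+ 3) =
            C0 ^+ 3 * (2 * fine (mu (y D `\` rest (y D)))) by ring.
  rewrite ler_pM2l//; lra.
move=> D D' SPD SPD' [x [[Yx nRx] [Yx' nRx']]].
have [SY pY DY] := yP D SPD; have [SY' pY' DY'] := yP D' SPD'.
have touch : y D `&` y D' !=set0 by exists x.
have gap k l : odd k = p -> odd l = p -> (k < l)%N -> (k.+2 <= l)%N.
  move=> kp lp; rewrite leq_eqVlt => /predU1P[kl|//].
  by move: lp; rewrite -kl /= kp; case: (p).
have [lt|lt|eqlv] := ltngtP (lv (y D)) (lv (y D')).
- exfalso; apply: nRx; exists (y D') => //; split=> //; last exact: gap.
  by rewrite setIC.
- by exfalso; apply: nRx'; exists (y D) => //; split=> //; exact: gap.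
- by rewrite DY DY'; congr (iter 3 star _); exact: S_level.
Qed.

End sparse_parts.
(** * Power integrals and averages *)

Section power_integrals.
Context d (X : measurableType d) (R : realType).
Context (mu : {measure set X -> \bar R}) (r : R) (r_ge1 : 1 <= r).
Local Notation sz A := (fine (mu A)).
Local Notation Lr := (Lfun mu r%:E).
Implicit Types (g u v : X -> R) (B E : set X).

Definition powint B g : \bar R := (\int[mu]_(x in B) (`|g x| `^ r)%:E)%E.

Let r_gt0 : 0 < r. Proof. exact: lt_le_trans ltr01 r_ge1. Qed.
Let r_neq0 : r != 0. Proof. by rewrite gt_eqF. Qed.

Lemma Lfun_measurable g : g \in Lr -> measurable_fun setT g.
Proof. by move=> /sub_Lfun_mfun /set_mem. Qed.

Lemma measurable_powabs g : measurable_fun setT g ->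
  measurable_fun setT (EFin \o (fun x => `|g x| `^ r)).
Proof.
move=> mg; apply/measurable_EFinP.
by apply: (measurableT_comp (measurable_powR r)); exact: measurableT_comp.
Qed.

Lemma powint_ge0 B g : (0 <= powint B g)%E.
Proof. by apply: integral_ge0 => x _; rewrite lee_fin powR_ge0. Qed.

Lemma Lnorm_powint g : ('N[mu]_r%:E[EFin \o g] = powint setT g `^ r^-1)%E.
Proof. by rewrite unlock /powint. Qed.

Lemma LfunE g :
  g \in Lr <-> measurable_fun setT g /\ (powint setT g < +oo)%E.
Proof.
split=> [gL|[mg goo]].
  split; first exact: Lfun_measurable.
  have h : finite_norm mu r%:E g by exact: set_mem (sub_Lfun_finLfun gL).
  rewrite /finite_norm Lnorm_powint in h.
  rewrite ltey; apply/eqP => e; move: h.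
  by rewrite e poweRyr ?ltxx// invr_neq0.
apply/andP; split; first exact/mem_set.
apply/mem_set; change (finite_norm mu r%:E g).
by rewrite /finite_norm Lnorm_powint poweR_lty.
Qed.

Lemma powint_subset B E g : measurable B -> measurable E -> measurable_fun setT g ->
  B `<=` E -> (powint B g <= powint E g)%E.
Proof.
move=> mB mE mg BE; apply: ge0_subset_integral => //.
by apply: measurable_funTS; exact: measurable_powabs.
Qed.

Lemma Lfun_powint_lty B g : measurable B -> g \in Lr -> (powint B g < +oo)%E.
Proof.
move=> mB /LfunE[mg]; apply: le_lt_trans; exact: powint_subset.
Qed.

Lemma powint_restrict B E g : powint B (g \* \1_E) = powint (B `&` E) g.
Proof.
rewrite /powint integral_mkcondr; apply: eq_integral => x _.
rewrite patchE /= indicE; case: ifPn => _.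
  by rewrite mulr1.
by rewrite mulr0 normr0 powR0.
Qed.

Lemma Lfun_restrict E g : measurable E -> g \in Lr -> g \* \1_E \in Lr.
Proof.
move=> mE gL; have /LfunE[mg goo] := gL; apply/LfunE; split.
  by apply: measurable_funM => //; exact: measurable_indic.
by rewrite powint_restrict setTI; exact: Lfun_powint_lty.
Qed.

Lemma powR_normD_le (s t : R) : `|s + t| `^ r <= 2 `^ r * (`|s| `^ r + `|t| `^ r).
Proof.
wlog st : s t / `|s| <= `|t|.
  move=> H; have [st|/ltW ts] := leP `|s| `|t|; first exact: H.
  by rewrite addrC [leRHS](_ : _ = 2 `^ r * (`|t| `^ r + `|s| `^ r)) ?H// addrC.
apply: le_trans (_ : (2 * `|t|) `^ r <= _).
  rewrite ge0_ler_powR ?nnegrE ?(ltW r_gt0)//.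
  by rewrite (le_trans (ler_normD _ _))// mulr_natl mulr2n lerD2r.
by rewrite powRM// ler_wpM2l ?powR_ge0// lerDr powR_ge0.
Qed.

Lemma powint_lin_le B (c : R) u v : measurable B ->
  measurable_fun setT u -> measurable_fun setT v ->
  (powint B (fun x => (c * u x + v x)%R)
     <= (2 `^ r)%:E * ((`|c| `^ r)%:E * powint B u + powint B v))%E.
Proof.
move=> mB mu' mv; rewrite /powint.
have mpu := measurable_funTS (measurable_powabs mu') : measurable_fun B _.
have mpv := measurable_funTS (measurable_powabs mv) : measurable_fun B _.
have pos w x : (0 <= (`|w x| `^ r)%:E :> \bar R)%E by rewrite lee_fin powR_ge0.
have -> : ((`|c| `^ r)%:E * \int[mu]_(x in B) (`|u x| `^ r)%:E =
    \int[mu]_(x in B) ((`|c| `^ r)%:E * (`|u x| `^ r)%:E))%E.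
  by rewrite ge0_integralZl_EFin// powR_ge0.
have mcu : measurable_fun B (fun x => (`|c| `^ r)%:E * (`|u x| `^ r)%:E)%E.
  exact: measurable_funeM.
rewrite -ge0_integralD//.
rewrite -ge0_integralZl_EFin ?powR_ge0//; last exact: emeasurable_funD;
  last by move=> x _; rewrite adde_ge0 ?mule_ge0.
apply: ge0_le_integral => //.
- apply: measurable_funTS; apply: measurable_powabs.
  by apply: measurable_funD => //; apply: measurable_funM.
- by apply: measurable_funeM; exact: emeasurable_funD.
- move=> x _; rewrite -!(EFinM, EFinD) lee_fin.
  by rewrite -powRM// -normrM; exact: powR_normD_le.
Qed.

Lemma Lfun_lin (c : R) u v : u \in Lr -> v \in Lr -> (fun x => (c * u x + v x)%R) \in Lr.
Proof.
move=> uL vL; have /LfunE[mu' uoo] := uL; have /LfunE[mv voo] := vL.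
apply/LfunE; split.
  by apply: measurable_funD => //; apply: measurable_funM.
apply: le_lt_trans (powint_lin_le _ _ _ _) _ => //.
have pos (t : R) : (0 <= (t `^ r)%:E)%E by rewrite lee_fin powR_ge0.
have cuoo := lte_mul_pinfty (pos `|c|) isT uoo.
exact: lte_mul_pinfty (pos 2) isT (lte_add_pinfty cuoo voo).
Qed.

Lemma Lfun_scale_r (a : R) (g : X -> R) : g \in Lr -> (fun y => a * g y) \in Lr.
Proof.
move=> gL.
have -> : (fun y => a * g y) = (fun y => a * g y + (g \* \1_set0) y).
  by apply/funext => y /=; rewrite indicE in_set0 mulr0 addr0.
by apply: Lfun_lin => //; exact: Lfun_restrict.
Qed.

Lemma Lfun_add (g h : X -> R) : g \in Lr -> h \in Lr -> g \+ h \in Lr.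
Proof.
move=> gL hL; have -> : g \+ h = (fun y => 1 * g y + h y).
  by apply/funext => y /=; rewrite mul1r.
exact: Lfun_lin.
Qed.

End power_integrals.

Section averages.
Context d (X : measurableType d) (R : realType).
Context (mu : {measure set X -> \bar R}) (r : R) (r_ge1 : 1 <= r).
Local Notation sz A := (fine (mu A)).
Local Notation Lr := (Lfun mu r%:E).
Local Notation powint := (powint mu r).
Implicit Types (g u v : X -> R) (B E : set X).

Definition avg B g : R := fine (avg_r mu r B g).

Let r_gt0 : 0 < r. Proof. exact: lt_le_trans ltr01 r_ge1. Qed.
Let r_neq0 : r != 0. Proof. by rewrite gt_eqF. Qed.

Lemma avg_ge0 B g : 0 <= avg B g.
Proof. by rewrite fine_ge0// poweR_ge0. Qed.

Lemma avgE B g : measurable B -> 0 < sz B -> g \in Lr ->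
  avg_r mu r B g = (avg B g)%:E /\ powint B g = (avg B g `^ r * sz B)%:E.
Proof.
move=> mB B0 gL.
have Ioo := Lfun_powint_lty r_ge1 mB gL.
have I0 := powint_ge0 mu r B g.
have IE : powint B g = (fine (powint B g))%:E by rewrite fineK// ge0_fin_numE.
have fI0 : 0 <= fine (powint B g) by rewrite fine_ge0.
have muE : mu B = (sz B)%:E.
  rewrite fineK//; move: B0; rewrite -lte_fin; case: (mu B) => //=.
    by rewrite ltxx.
  by rewrite ltxx.
have avgrE : avg_r mu r B g = (((sz B)^-1 * fine (powint B g)) `^ r^-1)%:E.
  by rewrite /avg_r -/(powint B g) IE muE inver gt_eqF.
split; first by rewrite /avg avgrE.
rewrite /avg avgrE/= IE -powRrM mulVf// powRr1.
  by congr EFin; rewrite mulrAC mulVf ?mul1r// gt_eqF.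
by rewrite mulr_ge0// invr_ge0 ltW.
Qed.

Lemma avg_le B g (a : R) : measurable B -> 0 < sz B -> g \in Lr -> 0 <= a ->
  (powint B g <= (a `^ r * sz B)%:E)%E -> avg B g <= a.
Proof.
move=> mB B0 gL a0; have [_ ->] := avgE mB B0 gL.
rewrite lee_fin ler_pM2r// => h; rewrite leNgt; apply/negP => h'.
move: h; apply/negP; rewrite -ltNge.
by apply: gt0_ltr_powR => //; rewrite nnegrE// avg_ge0.
Qed.

Lemma powR_homo (a b : R) : 0 <= a -> a <= b -> a `^ r <= b `^ r.
Proof.
move=> a0 ab; apply: ge0_ler_powR => //; rewrite ?nnegrE ?(ltW r_gt0)//.
exact: le_trans ab.
Qed.

Lemma avg_lin_le B (c : R) u v : measurable B -> 0 < sz B ->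
  u \in Lr -> v \in Lr ->
  avg B (fun x => (c * u x + v x)%R) <= 4 * (`|c| * avg B u + avg B v).
Proof.
move=> mB B0 uL vL; have [_ uE] := avgE mB B0 uL; have [_ vE] := avgE mB B0 vL.
have a0 : 0 <= `|c| * avg B u by rewrite mulr_ge0// avg_ge0.
have b0 := avg_ge0 B v.
have c0 := mulr_ge0 (ler0n R 4) (addr_ge0 a0 b0).
apply: (avg_le mB B0 (Lfun_lin r_ge1 c uL vL) c0).
apply: (le_trans (powint_lin_le mu r_ge1 c mB (Lfun_measurable uL) (Lfun_measurable vL))).
rewrite uE vE -!(EFinM, EFinD) lee_fin mulrA -powRM ?avg_ge0//.
rewrite -mulrDl mulrA ler_wpM2r ?(ltW B0)//.
move: a0 b0; move: (`|c| * avg B u) (avg B v) => a b a0 b0.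
have ab0 := addr_ge0 a0 b0.
have -> : 4 * (a + b) = 2 * (2 * (a + b)) by ring.
rewrite (powRM _ (ler0n _ 2) (mulr_ge0 (ler0n _ 2) ab0)) ler_wpM2l ?powR_ge0//.
rewrite (powRM _ (ler0n _ 2) ab0).
have h1 : a `^ r <= (a + b) `^ r by apply: powR_homo => //; rewrite lerDl.
have h2 : b `^ r <= (a + b) `^ r by apply: powR_homo => //; rewrite lerDr.
have h3 : 2 <= 2 `^ r :> R by rewrite le1r_powR// ler1n.
have h4 := powR_ge0 (a + b) r.
by apply: le_trans (lerD h1 h2) _; rewrite -mulr2n -[leLHS]mulr_natl ler_wpM2r.
Qed.

End averages.
(** * Weak type estimates *)

Section weak_type.
Context d (X : measurableType d) (R : realType).
Context (mu : {measure set X -> \bar R}) (ball : set (set X)).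
Context (star : set X -> set X) (C0 : R).
Context (bb : ball_basis mu ball star C0) (r : R) (r_ge1 : 1 <= r).
Local Notation sz A := (fine (mu A)).
Local Notation Lr := (Lfun mu r%:E).
Local Notation powint := (powint mu r).
Local Notation avg := (avg mu r).

Lemma esum_powint_le (W : set (set X)) (g : X -> R) :
  (forall A, W A -> measurable A) -> trivIset W id -> measurable_fun setT g ->
  (\esum_(A in W) powint A g <= powint setT g)%E.
Proof.
move=> mW tW mg; apply: ge_ereal_sup => _ [Y [finY YW] <-].
pose F (A : set X) := if A \in Y then A else set0.
have mF A : measurable (F A).
  by rewrite /F; case: ifPn => // /set_mem /YW/mW.
rewrite fsbig_finite//=.
have memY A : A \in fset_set Y -> F A = A.
  by rewrite in_fset_set// /F => ->.
have -> : \sum_(A <- fset_set Y) powint A g =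
          \sum_(A <- fset_set Y) powint (F A) g.
  by rewrite big_seq [RHS]big_seq; apply: eq_bigr => A AY; rewrite memY.
rewrite -(ge0_integral_bigsetU mu mF (fset_uniq _))//=.
- apply: powint_subset => //.
  by apply: bigsetU_measurable => A _; exact: mF.
- move=> A B /= AY BY; rewrite !memY//; apply: tW; apply: YW.
    by move: AY; rewrite in_fset_set// => /set_mem.
  by move: BY; rewrite in_fset_set// => /set_mem.
- by apply: measurable_funTS; exact: measurable_powabs.
Qed.

(** The weak type inequality for the maximal function of the family of balls;
    as uncountable unions of balls need not be measurable, the level set is
    replaced by the countable union of stars that covers it. *)
Lemma maximal_level_set (g : X -> R) (t : R) : g \in Lr -> 0 < t ->
  exists U, [/\ measurable U, (mu U <= (C0 / t)%:E * powint setT g)%E &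
    forall x B, ~ U x -> ball B -> B x -> (powint B g <= t%:E * mu B)%E].
Proof.
move=> gL t0; have mg := Lfun_measurable gL.
have Ioo := Lfun_powint_lty r_ge1 measurableT gL.
have I0 := powint_ge0 mu r setT g.
have IE : powint setT g = (fine (powint setT g))%:E by rewrite fineK// ge0_fin_numE.
pose G := [set B | ball B /\ (t%:E * mu B < powint B g)%E].
have Gb : G `<=` ball by move=> B [].
have mG A : G A -> measurable A by move=> /Gb; exact: (ball_measurable bb).
have GleE A : G A -> (mu A <= t^-1%:E * powint A g)%E.
  by move=> [_ /ltW h]; rewrite lee_pdivlMl.
have [A GA|W [WG tW Wcov]] := vitali_subfamily bb (K := t^-1 * fine (powint setT g)) Gb.
  rewrite -lee_fin -(ball_muE bb (Gb _ GA)) EFinM -IE.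
  apply: le_trans (GleE _ GA) _; rewrite lee_pmul2l ?lte_fin ?invr_gt0//.
  by apply: powint_subset => //; exact: mG.
have Wb : W `<=` ball by move=> A /WG/Gb.
have sumW : (\esum_(A in W) mu A <= t^-1%:E * powint setT g)%E.
  apply: le_trans (_ : (_ <= \esum_(A in W) (t^-1%:E * powint A g))%E) _.
    by apply: le_esum => A /WG/GleE.
  apply: le_trans (esumZl _ _) _.
  - by rewrite invr_ge0 ltW.
  - by move=> A _; exact: powint_ge0.
  rewrite lee_pmul2l ?lte_fin ?invr_gt0//.
  by apply: esum_powint_le => // A /WG/mG.
have cW : countable W.
  apply: (@countable_of_esum _ _ _ (fun A => mu A)).
    by move=> A /Wb/(ball_measure bb)/andP[].
  by apply: le_lt_trans sumW _; rewrite IE -EFinM ltry.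
exists (\bigcup_(A in W) star A); split.
- apply: countable_bigcup_measurable => // A /Wb/(star_ball bb).
  exact: (ball_measurable bb).
- apply: le_trans (measure_starcover bb Wb cW) _.
  rewrite EFinM -muleA; apply: lee_wpmul2l => //.
  by rewrite lee_fin ltW// (C0_gt0 bb).
- move=> x B nU bB Bx; rewrite leNgt; apply/negP => h.
  have GB : G B by split.
  have [Y WY [BY sY]] := Wcov _ GB.
  by apply: nU; exists Y => //; exact: (star_swallow bb bB (Wb _ WY) BY sY).
Qed.

(** The case [a = 0] is separate: then [g] has no mass, and no point need be
    excluded. *)
Lemma maximal_bound (g : X -> R) (a L M : R) : g \in Lr -> 0 <= a -> 1 <= L ->
  0 < M -> (powint setT g <= (2 * a `^ r * M)%:E)%E ->
  exists U, [/\ measurable U, (mu U <= (2 * C0 / L * M)%:E)%E &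
    forall x B, ~ U x -> ball B -> B x -> avg B g <= L * a].
Proof.
move=> gL a0 L1 M0 gM; have mg := Lfun_measurable gL.
have L0 : 0 < L by lra.
have La0 : 0 <= L * a by rewrite mulr_ge0// ltW.
have r0 : 0 < r := lt_le_trans ltr01 r_ge1.
have [a_eq0|a_neq0] := eqVneq a 0.
  exists set0; split => //.
    by rewrite measure0 lee_fin !mulr_ge0 ?invr_ge0 ?(ltW (C0_gt0 bb)) ?(ltW L0) ?(ltW M0).
  move=> x B _ bB Bx; have mB := ball_measurable bb bB.
  apply: (avg_le r_ge1 mB (ball_size_gt0 bb bB) gL La0).
  apply: (@le_trans _ _ (powint setT g)); first exact: powint_subset.
  by move: gM; rewrite a_eq0 mulr0 powR0 ?gt_eqF// mulr0 !mul0r.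
have ap : 0 < a `^ r by rewrite powR_gt0// lt_neqAle eq_sym a_neq0.
have [U [mU muU HU]] := maximal_level_set gL (mulr_gt0 L0 ap).
exists U; split=> //.
  apply: le_trans muU _; apply: le_trans (lee_wpmul2l _ gM) _.
    by rewrite lee_fin divr_ge0 ?(ltW (C0_gt0 bb))// ltW// mulr_gt0.
  rewrite -EFinM lee_fin le_eqVlt; apply/orP; left; apply/eqP; field.
  by rewrite !gt_eqF.
move=> x B nU bB Bx; have mB := ball_measurable bb bB.
apply: (avg_le r_ge1 mB (ball_size_gt0 bb bB) gL La0).
apply: le_trans (HU _ _ nU bB Bx) _.
rewrite (ball_muE bb bB) -EFinM lee_fin ler_wpM2r ?(ltW (ball_size_gt0 bb bB))//.
rewrite powRM ?(ltW L0)// ler_wpM2r ?(ltW ap)//.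
exact: le1r_powR.
Qed.

Lemma measurable_abs_gt (g : X -> R) (t : R) : measurable_fun setT g ->
  measurable [set x | t < `|g x|].
Proof.
move=> mg; have mng : measurable_fun setT (fun x => `|g x|) by exact: measurableT_comp.
have := mng measurableT _ (measurable_itv `]t, +oo[); rewrite setTI.
by congr measurable; apply/seteqP; split=> x /=; rewrite in_itv/= andbT.
Qed.

(** The level is raised by [k ^+ m] in order to gain [k `^ (- r)], hence at
    least [k^-1], in measure, as the target space has exponent [r / m].  When
    some [a i] vanishes the level is zero, and the claim is that [T g] vanishes
    almost everywhere. *)
Lemma weak_level_set (m : nat) (T : ('I_m -> X -> R) -> X -> R) (c k M : R)
    (g : 'I_m -> X -> R) (a : 'I_m -> R) : (0 < m)%N -> 0 < c ->
  weak_bound mu r T c -> measurable_fun setT (T g) -> Lvec mu r g ->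
  1 <= k -> 0 <= M -> (forall i, 0 <= a i) ->
  (forall i, powint setT (g i) <= (a i `^ r * M)%:E)%E ->
  (mu [set x | (k ^+ m * c * \prod_(i < m) a i < `|T g x|)%R] <= (k^-1 * M)%:E)%E.
Proof.
move=> m0 c0 [_ /(_ g) wT] mT gL k1 M0 a0 gM.
have r0 : 0 < r := lt_le_trans ltr01 r_ge1.
have k0 : 0 < k by lra.
have mR : 0 < m%:R :> R by rewrite ltr0n.
set q := m%:R / r.
have q0 : 0 < q by rewrite divr_gt0.
set P := \prod_(i < m) a i.
have P0 : 0 <= P by apply: prodr_ge0.
have wt (t : R) : 0 < t ->
    (t%:E * (mu [set x | (t < `|T g x|)%R]) `^ q <= (c * (P * M `^ q))%:E)%E.
  move=> t0; apply: le_trans (_ : (_ <= weak_norm mu (r / m%:R) (T g))%E) _.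
    apply: ereal_sup_ubound; exists t => //.
    by rewrite invf_div.
  apply: le_trans (wT gL) _; rewrite EFinM; apply: lee_wpmul2l.
    by rewrite lee_fin ltW.
  have Nle i : ('N[mu]_r%:E[EFin \o g i] <= (a i * M `^ r^-1)%:E)%E.
    rewrite Lnorm_powint.
    have -> : (a i * M `^ r^-1)%:E = ((a i `^ r * M)%:E `^ r^-1)%E.
      by rewrite poweR_EFin powRM ?powR_ge0// -powRrM mulfV ?gt_eqF// powRr1.
    have ri0 : 0 <= r^-1 by rewrite invr_ge0 ltW.
    apply: (gt0_ler_poweR ri0); last exact: gM.
      by rewrite in_itv/= powint_ge0 leey.
    by rewrite in_itv/= leey andbT lee_fin mulr_ge0// powR_ge0.
  have NE i : ('N[mu]_r%:E[EFin \o g i] = (fine 'N[mu]_r%:E[EFin \o g i])%:E)%E.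
    rewrite fineK// ge0_fin_numE ?Lnorm_ge0//.
    by apply: le_lt_trans (Nle i) _; rewrite ltry.
  under eq_bigr do rewrite NE.
  rewrite prodEFin lee_fin.
  have -> : P * M `^ q = \prod_(i < m) (a i * M `^ r^-1).
    rewrite big_split/= prodr_const card_ord -powR_mulrn ?powR_ge0//.
    by rewrite -powRrM [r^-1 * _]mulrC.
  apply: ler_prod => i _; rewrite fine_ge0 ?Lnorm_ge0//=.
  by rewrite -lee_fin -NE.
have mlev (t : R) : measurable [set x | t < `|T g x|] by exact: measurable_abs_gt.
have [Peq0|Pn0] := eqVneq P 0; last first.
  have Pp : 0 < P by rewrite lt_neqAle eq_sym Pn0.
  have km0 : 0 < k ^+ m by rewrite exprn_gt0.
  have t0 : 0 < k ^+ m * c * P by rewrite !mulr_gt0.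
  have := wt _ t0; set s := mu _; rewrite -lee_pdivlMl// -EFinM.
  have -> : (k ^+ m * c * P)^-1 * (c * (P * M `^ q)) = k `^ (- m%:R) * M `^ q.
    rewrite powR_invn ?(ltW k0)//; field.
    by rewrite (gt_eqF km0) (gt_eqF Pp) (gt_eqF c0).
  move=> sq; have s0 : (0 <= s)%E by exact: measure_ge0.
  have -> : s = ((s `^ q) `^ q^-1)%E by rewrite -poweRrM mulfV ?gt_eqF// poweRe1.
  have qi0 : 0 <= q^-1 by rewrite invr_ge0 ltW.
  apply: le_trans (gt0_ler_poweR qi0 _ _ sq) _.
  - by rewrite in_itv/= poweR_ge0 leey.
  - by rewrite in_itv/= leey andbT lee_fin mulr_ge0// powR_ge0.
  rewrite poweR_EFin lee_fin powRM ?powR_ge0// -!powRrM mulfV ?gt_eqF// powRr1//.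
  rewrite ler_wpM2r//.
  have -> : - m%:R * q^-1 = - r by rewrite /q invf_div; field; rewrite gt_eqF.
  by rewrite -powR_inv1 ?(ltW k0)// ler_powR// lerN2.
rewrite Peq0 mulr0.
have -> : mu [set x | 0 < `|T g x|] = 0%E; last first.
  by rewrite lee_fin mulr_ge0// invr_ge0 ltW.
apply/negligibleP; first exact: mlev.
apply: negligibleS (_ : mu.-negligible (\bigcup_n [set x | n.+1%:R^-1 < `|T g x|])).
  move=> x /= Tx; exists (Num.truncn `|T g x|^-1) => //=.
  by rewrite invf_plt ?posrE// truncnS_gt.
apply: negligible_bigcup => n; apply/negligibleP; first exact: mlev.
have n0 : (0 < n.+1%:R^-1 :> R) by rewrite invr_gt0.
have := wt _ n0; rewrite Peq0 mul0r mulr0 => h.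
apply: (@poweR_eq0_eq0 _ _ q) => //; apply/eqP; rewrite eq_le poweR_ge0 andbT.
rewrite leNgt; apply/negP => h'; move: h; apply/negP; rewrite -ltNge.
by rewrite mule_gt0 ?lte_fin.
Qed.

End weak_type.
(** * Concentration of the data in one ball *)

(** A Lipschitz function on the line that grows at infinity attains its
    minimum: [N t] below is the norm of [t *: f + h] and [a] that of [f]. *)
Lemma lipschitz_coercive_min (R : realType) (a : R) (N : R -> R) :
  0 <= a -> (forall t, 0 <= N t) ->
  (forall s t, N t <= N s + `|t - s| * a) ->
  (forall t, `|t| * a <= N t + N 0) ->
  exists c, forall t, N c <= N t.
Proof.
move=> a0 N0 lip grow; have [aE|an0] := eqVneq a 0.
  by exists 0 => t; have := lip t 0; rewrite aE mulr0 addr0.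
have ap : 0 < a by rewrite lt_neqAle eq_sym an0.
pose A := 2 * N 0 / a.
have A0 : 0 <= A by rewrite divr_ge0// mulr_ge0.
have cN : continuous N.
  move=> x; apply/cvgrPdist_le => e e0; near=> y.
  have exy : `|x - y| <= e / a.
    by near: y; apply: cvgr_dist_le; [exact: cvg_id|exact: divr_gt0].
  have {}exy : `|x - y| * a <= e by rewrite -ler_pdivlMr.
  have h1 := lip x y; have h2 := lip y x; rewrite distrC in h1.
  by rewrite ler_norml; apply/andP; split; lra.
have AA : - A <= A by lra.
have [c cI cmin] := @EVT_min _ _ (- A) A AA (continuous_subspaceT cN).
exists c => t; have [tA|tA] := leP `|t| A.
  by apply: cmin; rewrite in_itv/= -ler_norml.
have h0 : N c <= N 0.
  by apply: cmin; rewrite in_itv/= oppr_le0 A0.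
apply: le_trans h0 _.
by have := grow t; move: tA; rewrite /A ltr_pdivrMr//; lra.
Unshelve. all: by end_near.
Qed.

Section concentration.
Context d (X : measurableType d) (R : realType).
Context (mu : {measure set X -> \bar R}) (r : R) (r_ge1 : 1 <= r).
Local Notation Lr := (Lfun mu r%:E).
Local Notation powint := (powint mu r).
Local Notation tot g := (fine (powint setT g)).

Let r_gt0 : 0 < r. Proof. exact: lt_le_trans ltr01 r_ge1. Qed.

Lemma Lfun_totE (g : X -> R) : g \in Lr -> powint setT g = (tot g)%:E.
Proof.
move=> gL; rewrite fineK// ge0_fin_numE ?powint_ge0//.
exact: Lfun_powint_lty.
Qed.

Lemma tail_vanishes (G : nat -> set X) (g : X -> R) (e : R) :
  (forall n, measurable (G n)) ->
  (forall x, exists n0, forall n, (n0 <= n)%N -> G n x) ->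
  g \in Lr -> 0 < e ->
  exists n0, forall n, (n0 <= n)%N -> (powint (~` G n) g <= (e * tot g)%:E)%E.
Proof.
move=> mG Gx gL e0; have mg := Lfun_measurable gL.
have [g0|gn0] := eqVneq (tot g) 0.
  exists 0%N => n _; rewrite g0 mulr0 -g0 -Lfun_totE//.
  by apply: powint_subset => //; exact: measurableC.
have tg0 : 0 < e * tot g.
  by rewrite mulr_gt0// lt_neqAle eq_sym gn0 fine_ge0// powint_ge0.
pose h x := (`|g x| `^ r)%:E.
have mh : measurable_fun setT h by exact: measurable_powabs.
have h0 x : (0 <= h x)%E by rewrite lee_fin powR_ge0.
have := @dominated_cvg _ _ _ mu setT measurableT
  (fun n => h \_ (~` G n)) (cst 0%E) h.
rewrite integral0 => H.
have {}H : (\int[mu]_x (h \_ (~` G n)) x)%E @[n --> \oo] --> 0%E.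
  apply: H.
  - move=> n; apply/(measurable_restrictT _ _).1 => //; first exact: measurableC.
    exact: measurable_funTS.
  - move=> x _; have [n0 Hn0] := Gx x; apply: cvg_near_cst.
    exists n0 => // n /= n0n; rewrite patchE ifF//.
    by apply/negP => /set_mem; apply; exact: Hn0.
  - by move=> x _.
  - apply/integrableP; split=> //.
    have := Lfun_powint_lty r_ge1 measurableT gL; rewrite /powint.
    by under eq_integral => x _ do rewrite -[(_)%:E]gee0_abs//.
  - move=> n x _; rewrite patchE; case: ifP => _; first by rewrite gee0_abs.
    by rewrite abse0.
have [n0 _ Hn0] : \forall n \near \oo, (\int[mu]_x (h \_ (~` G n)) x < (e * tot g)%:E)%E.
  have := @open_ereal_lt' R 0%E (e * tot g)%:E; rewrite lte_fin => /(_ tg0) nb.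
  exact: (H _ nb).
exists n0 => n n0n; have := Hn0 n n0n => /= /ltW.
by rewrite -integral_mkcond.
Qed.

Lemma powint_scale (c : R) (g : X -> R) : measurable_fun setT g ->
  powint setT (fun x => (c * g x)%R) = ((`|c| `^ r)%:E * powint setT g)%E.
Proof.
move=> mg; rewrite /powint -ge0_integralZl_EFin ?powR_ge0//; last first.
  exact: measurable_powabs.
by apply: eq_integral => x _; rewrite normrM powRM// EFinM.
Qed.

Lemma tot_ge0 g : 0 <= tot g.
Proof. by rewrite fine_ge0// powint_ge0. Qed.

Lemma tot_scale (c : R) (g : X -> R) : g \in Lr ->
  tot (fun x => c * g x) = `|c| `^ r * tot g.
Proof.
move=> gL; rewrite (powint_scale _ (Lfun_measurable gL)).
by rewrite fineM// (Lfun_totE gL).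
Qed.

Lemma tot_lin_le (c : R) (u v : X -> R) : u \in Lr -> v \in Lr ->
  tot (fun x => c * u x + v x) <= 2 `^ r * (`|c| `^ r * tot u + tot v).
Proof.
move=> uL vL; rewrite -lee_fin -(Lfun_totE (Lfun_lin r_ge1 c uL vL)).
rewrite EFinM EFinD EFinM -(Lfun_totE uL) -(Lfun_totE vL).
exact: (powint_lin_le mu r_ge1 c measurableT (Lfun_measurable uL) (Lfun_measurable vL)).
Qed.

(** The minimum is attained since, by Minkowski's inequality, the norm is a
    Lipschitz function of the parameter that grows at infinity. *)
Lemma affine_tot_min (f h : X -> R) : f \in Lr -> h \in Lr ->
  exists c, forall t, tot (fun x => c * f x + h x) <= tot (fun x => t * f x + h x).
Proof.
move=> fL hL; pose w t := fun x => t * f x + h x.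
have wL t : w t \in Lr by exact: Lfun_lin.
pose nrm g := tot g `^ r^-1.
have nrmE g : g \in Lr -> 'N[mu]_r%:E[EFin \o g]%E = (nrm g)%:E.
  by move=> gL; rewrite Lnorm_powint (Lfun_totE gL) poweR_EFin.
have nrm_c t g : g \in Lr -> nrm (fun x => t * g x) = `|t| * nrm g.
  move=> gL.
  rewrite /nrm tot_scale// powRM ?powR_ge0 ?tot_ge0//.
  by rewrite -powRrM mulfV ?gt_eqF// powRr1.
have nrmD u v : u \in Lr -> v \in Lr -> nrm (u \+ v) <= nrm u + nrm v.
  move=> uL vL.
  have uvL := Lfun_add r_ge1 uL vL.
  have := minkowski_EFin mu (Lfun_measurable uL) (Lfun_measurable vL) r_ge1.
  by rewrite (nrmE _ uvL) (nrmE _ uL) (nrmE _ vL) -EFinD lee_fin.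
have lip s t : nrm (w t) <= nrm (w s) + `|t - s| * nrm f.
  rewrite -(nrm_c _ _ fL); apply: le_trans (nrmD _ _ (wL s) (Lfun_scale_r r_ge1 (t - s) fL)).
  rewrite le_eqVlt; apply/orP; left; apply/eqP; congr nrm.
  by apply/funext => x; rewrite /w /=; ring.
have grow t : `|t| * nrm f <= nrm (w t) + nrm (w 0).
  rewrite -(nrm_c _ _ fL) -[nrm (w 0)]mul1r -[X in X * nrm (w 0)](normrN1 R).
  rewrite -(nrm_c _ _ (wL 0)).
  apply: le_trans (nrmD _ _ (wL t) (Lfun_scale_r r_ge1 (-1) (wL 0))).
  rewrite le_eqVlt; apply/orP; left; apply/eqP; congr nrm.
  by apply/funext => x; rewrite /w /=; ring.
have [c Hc] := lipschitz_coercive_min (powR_ge0 _ _)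
  (fun t => powR_ge0 (tot (w t)) _) lip grow.
have tE s : tot (w s) = nrm (w s) `^ r.
  by rewrite /nrm -powRrM mulVf ?gt_eqF// powRr1 ?tot_ge0.
exists c => t; change (tot (w c) <= tot (w t)); rewrite (tE c) (tE t).
by apply: powR_homo r_ge1 _ _ _ (Hc t); exact: powR_ge0.
Qed.

Lemma concentrated_of_tail (E : set X) (g : X -> R) :
  measurable E -> g \in Lr ->
  (powint (~` E) g <= (2^-1 * tot g)%:E)%E ->
  (powint setT g <= 2%:E * powint E g)%E.
Proof.
move=> mE gL tailg; have gE := Lfun_totE gL.
have Eoo := Lfun_powint_lty r_ge1 mE gL.
have EE : powint E g = (fine (powint E g))%:E.
  by rewrite fineK// ge0_fin_numE ?powint_ge0.
move: tailg gE EE; move: (tot g) (fine (powint E g)) => p q tailg gE EE.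
have : (powint setT g <= powint E g + (2^-1 * p)%:E)%E.
  apply: le_trans (leeD2l _ tailg).
  rewrite -(setUv E) /powint ge0_integral_setU//.
  - exact: measurableC.
  - apply: measurable_funTS; apply: measurable_powabs; exact: (Lfun_measurable gL).
  - by apply/disj_setPS => x [].
by rewrite EE gE -EFinD -EFinM !lee_fin; lra.
Qed.

(** Far out in the exhaustion, the mass of [c *: f + h] is concentrated for
    all [c] at once: if [v] is a member of least mass of this affine family
    then the masses of [(c - c0) *: f] and of [v] are both controlled by that
    of their sum, so the uniform bound follows from the smallness of the tails
    of [f] and [v]. *)
Lemma affine_concentration (G : nat -> set X) (f h : X -> R) :
  (forall n, measurable (G n)) ->
  (forall x, exists n0, forall n, (n0 <= n)%N -> G n x) ->
  f \in Lr -> h \in Lr ->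
  exists n0, forall n, (n0 <= n)%N -> forall c,
    (powint setT (fun x => (c * f x + h x)%R)
       <= 2%:E * powint (G n) (fun x => (c * f x + h x)%R))%E.
Proof.
move=> mG Gx fL hL; have [c0 c0min] := affine_tot_min fL hL.
pose w c := fun x => c * f x + h x.
have wL c : w c \in Lr by exact: Lfun_lin.
pose A : R := 2 `^ r; have A2 : 2 <= A by rewrite /A le1r_powR// ler1n.
pose k := (2 * (A * (2 * A + 1)))^-1.
have k0 : 0 < k by rewrite invr_gt0; nra.
have arith p q s t : t * p <= A * (s + q) -> s <= q -> 0 <= s ->
    A * (t * (k * p) + k * s) <= 2^-1 * q.
  move=> h1 h2 h3.
  have -> : A * (t * (k * p) + k * s) = (A * k) * (t * p + s) by ring.
  have -> : 2^-1 * q = (A * k) * ((2 * A + 1) * q).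
    by rewrite /k; field; apply/andP; split; apply/eqP; lra.
  have Ak0 : 0 <= A * k by apply: mulr_ge0; [lra|exact: ltW].
  by apply: ler_wpM2l => //; nra.
have [n1 Hf] := tail_vanishes mG Gx fL k0.
have [n2 Hv] := tail_vanishes mG Gx (wL c0) k0.
exists (maxn n1 n2) => n; rewrite geq_max => /andP[n1n n2n] c.
apply: (concentrated_of_tail (mG n) (wL c)).
have wE : w c = fun x => (c - c0) * f x + w c0 x.
  by apply/funext => x; rewrite /w; ring.
have mGc := measurableC (mG n).
have tailw := powint_lin_le mu r_ge1 (c - c0) mGc
  (Lfun_measurable fL) (Lfun_measurable (wL c0)).
rewrite -wE in tailw; apply: le_trans tailw _.
have cr0 := powR_ge0 `|c - c0| r.
apply: le_trans (lee_wpmul2l _ (leeD (lee_wpmul2l _ (Hf n n1n)) (Hv n n2n))) _.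
- by rewrite lee_fin powR_ge0.
- by rewrite lee_fin powR_ge0.
rewrite -!(EFinM, EFinD) lee_fin -/A.
have h1 : `|c - c0| `^ r * tot f <= A * (tot (w c0) + tot (w c)).
  rewrite -(tot_scale _ fL).
  have -> : (fun x => (c - c0) * f x) = fun x => (-1) * w c0 x + w c x.
    by apply/funext => x; rewrite /w; ring.
  apply: le_trans (tot_lin_le _ (wL c0) (wL c)) _.
  by rewrite normrN1 powR1 mul1r.
have h2 : tot (w c0) <= tot (w c) := c0min c.
have h3 := tot_ge0 (w c0).
exact: (arith _ _ _ _ h1 h2 h3).
Qed.

End concentration.

Section root_ball.
Context d (X : measurableType d) (R : realType).
Context (mu : {measure set X -> \bar R}) (ball : set (set X)).
Context (star : set X -> set X) (C0 : R).
Context (bb : ball_basis mu ball star C0) (r : R) (r_ge1 : 1 <= r).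
Local Notation Lr := (Lfun mu r%:E).
Local Notation powint := (powint mu r).

(** The number subtracted from [b i] in a node of the construction is its mean
    over a dilate of the node, so at the root it depends on [Q]; this is why
    [Q] has to serve all constants [c]. *)
Lemma root_ball (m : nat) (B : set X) (b f : 'I_m -> X -> R) (tau : {set 'I_m}) :
  ball B -> (forall i, f i \in Lr) ->
  (forall i, i \in tau -> (fun x => b i x * f i x) \in Lr) ->
  exists Q, [/\ ball Q, B `<=` Q,
    forall i, (powint setT (f i) <= 2%:E * powint Q (f i))%E &
    forall i c, i \in tau ->
      (powint setT (fun x => ((b i x - c) * f i x)%R)
        <= 2%:E * powint Q (fun x => ((b i x - c) * f i x)%R))%E].
Proof.
move=> bB fL bfL; have [x0 Bx0] := ball_nonempty bb bB.
have [G [bG GP]] := exhausting_balls bb x0.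
have mG n : measurable (G n) by exact: (ball_measurable bb).
have Gx x : exists n0, forall n, (n0 <= n)%N -> G n x.
  have [A bA [Ax0 Ax]] := ball_connect bb x0 x.
  by have [n0 H] := GP A bA Ax0; exists n0 => n /H; apply.
have [nB HB] := GP B bB Bx0.
have zL : (fun _ : X => 0 : R) \in Lr.
  apply/(LfunE mu r_ge1); split; first exact: measurable_cst.
  rewrite /powint; under eq_integral => x _ do rewrite normr0 powR0 ?gt_eqF ?(lt_le_trans ltr01 r_ge1)//.
  by rewrite integral0.
have ex i : exists n0, forall n, (n0 <= n)%N ->
    (powint setT (f i) <= 2%:E * powint (G n) (f i))%E /\
    (forall c, i \in tau ->
      (powint setT (fun x => ((b i x - c) * f i x)%R)
        <= 2%:E * powint (G n) (fun x => ((b i x - c) * f i x)%R))%E).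
  have [n1 H1] := affine_concentration r_ge1 mG Gx (fL i) zL.
  have fE : f i = fun x => 1 * f i x + 0.
    by apply/funext => x; rewrite mul1r addr0.
  have [iT|iT] := boolP (i \in tau); last first.
    by exists n1 => n n1n; split=> //; rewrite {1 2}fE; exact: H1.
  have [n2 H2] := affine_concentration r_ge1 mG Gx (fL i) (bfL i iT).
  exists (maxn n1 n2) => n; rewrite geq_max => /andP[n1n n2n]; split.
    by rewrite {1 2}fE; exact: H1.
  move=> c _.
  have -> : (fun x => (b i x - c) * f i x) = fun x => (- c) * f i x + b i x * f i x.
    by apply/funext => x; ring.
  exact: H2.
have [n0 Hn0] := choice ex.
pose n := maxn nB (\max_(i < m) n0 i).
have n0n i : (n0 i <= n)%N.
  by rewrite leq_max (leq_bigmax i) orbT.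
exists (G n); split=> //.
- by apply: HB; rewrite leq_max leqnn.
- by move=> i; have [] := Hn0 i n (n0n i).
- by move=> i c iT; have [_ +] := Hn0 i n (n0n i); apply.
Qed.

End root_ball.
(** * Sublinear operators *)

Section sublinear_operators.
Context d (X : measurableType d) (R : realType) (m : nat).
Context (mu : {measure set X -> \bar R}) (r : R) (r_ge1 : 1 <= r).
Local Notation Lr := (Lfun mu r%:E).
Local Notation vfun := ('I_m -> X -> R).
Implicit Types (T : vfun -> X -> R) (u v f : vfun).

Lemma Lvec_dfwith f i g : Lvec mu r f -> g \in Lr ->
  Lvec mu r (dfwith f i g).
Proof.
by move=> fL gL j; have [->|ij] := eqVneq j i; [rewrite dfwithin|rewrite dfwithout// eq_sym].
Qed.

Lemma norm_multilinear_sublinear (V : normedModType R) (Tv : vfun -> X -> V) T :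
  multilinear mu r Tv -> (forall f, Lvec mu r f -> forall x, `|T f x| = `|Tv f x|) ->
  multisublinear mu r T.
Proof.
move=> linT nT f i fL; have [TZ TD] := linT f i fL.
split=> [a x|g gL x].
  rewrite !nT//; first by rewrite TZ normrZ.
  by apply: Lvec_dfwith => //; exact: Lfun_scale_r.
rewrite !nT//; first by rewrite TD// ler_normD.
  exact: Lvec_dfwith.
by apply: Lvec_dfwith => //; exact: Lfun_add.
Qed.

(** The vector valued and the real valued operators are treated together: the
    oscillation conditions concern [Tv], all size estimates its norm. *)
Lemma bounded_oscillation_model ball star T (C1 C2 : R)
    (V : completeNormedModType R) :
  bounded_oscillation mu ball star r T C1 C2 V ->
  [/\ 0 < C1, 0 < C2, multisublinear mu r T &
  exists (W : normedModType R) (Tv : vfun -> X -> W),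
    [/\ forall f, Lvec mu r f -> forall x, `|T f x| = `|Tv f x|,
        oscillation_T1 mu ball star r Tv C1 &
        oscillation_T2 mu ball star r Tv C2]].
Proof.
case=> [W Tv C10 C20 linT nT T1 T2|C10 C20 linT T1 T2].
  have nT' f : Lvec mu r f -> forall x, `|T f x| = `|Tv f x|.
    by move=> fL x; rewrite nT// normr_id.
  by split=> //; [exact: (norm_multilinear_sublinear linT nT')|exists W, Tv].
split=> //; last by exists R^o, (T : vfun -> X -> R^o).
by case: linT => // linT; exact: (norm_multilinear_sublinear linT).
Qed.

(** The [i]-th entry is [c i *: u i + v i], [v i] or [u i] according as [i]
    lies in [t], in [s], or in neither. *)
Definition mixed (u v : vfun) (c : 'I_m -> R) (t s : {set 'I_m}) : vfun :=
  fun i y => if i \in t then c i * u i y + v i y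
             else if i \in s then v i y else u i y.

(** Expanding one entry after the other turns bounds on the tuples with entries
    [u i] or [v i] into a bound on the tuple with entries [c i *: u i + v i].
    The induction removes from [t] one entry at a time, whence the tuples in
    which some entries are already expanded. *)
Lemma sublinear_mixed T u v (c U V : 'I_m -> R) (K : R) (t : {set 'I_m}) (x : X) :
  multisublinear mu r T -> Lvec mu r u -> (forall i, i \in t -> v i \in Lr) ->
  (forall s : {set 'I_m}, s \subset t ->
    `|T (mixed u v c finset.set0 s) x|
       <= K * \prod_i (if i \in s then V i else U i)) ->
  `|T (mixed u v c t finset.set0) x|
     <= K * \prod_i (if i \in t then `|c i| * U i + V i else U i).
Proof.
move=> sT uL vL H.
suff gen n (s0 s : {set 'I_m}) : #|s0| = n -> (s0 :|: s)%SET \subset t -> [disjoint s0 & s]%bool ->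
    `|T (mixed u v c s0 s) x| <= K * \prod_i (if i \in s0 then `|c i| * U i + V i
      else if i \in s then V i else U i).
  have := gen _ t finset.set0 erefl; rewrite finset.setU0 subxx => /(_ isT).
  rewrite disjoint_sym finset.disjoints_subset finset.sub0set => /(_ isT).
  by congr (_ <= _ * _); apply: eq_bigr => i _; rewrite finset.in_set0.
elim: n s0 s => [|n ih] s0 s cs0 sub dis.
  move/eqP: cs0; rewrite cards_eq0 => /eqP s00; rewrite s00 finset.set0U in sub *.
  have := H s sub; congr (_ <= _ * _); apply: eq_bigr => i _.
  by rewrite finset.in_set0.
have [j js0] : exists j, j \in s0 by apply/card_gt0P; rewrite cs0.
have js : j \notin s by have := disjointFr dis js0 => ->.
pose s1 := (s0 :\ j)%SET.
have cs1 : #|s1| = n by move: cs0; rewrite (cardsD1 j) js0 => -[].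
have jt : j \in t by apply: (fintype.subsetP sub); rewrite !inE js0.
have s1t : (s1 :|: s)%SET \subset t.
  apply: fintype.subset_trans sub; apply: finset.setSU; exact: finset.subD1set.
have dis1 : [disjoint s1 & s]%bool.
  by apply: disjointWl dis; exact: finset.subD1set.
have ih1 := ih s1 s cs1 s1t dis1.
have s1t' : (s1 :|: (j |: s))%SET \subset t.
  apply/fintype.subsetP => i; rewrite !inE => /orP[/andP[_ is0]|/orP[/eqP->//|is_]].
    by apply: (fintype.subsetP sub); rewrite !inE is0.
  by apply: (fintype.subsetP sub); rewrite !inE is_ orbT.
have dis2 : [disjoint s1 & (j |: s)%SET]%bool.
  rewrite disjoint_sym finset.disjoints_subset; apply/fintype.subsetP => i.
  rewrite !inE => /orP[/eqP->|is_]; first by rewrite eqxx.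
  by rewrite negb_and; have := disjointFl dis is_ => ->; rewrite orbT.
have ih2 := ih s1 (j |: s)%SET cs1 s1t' dis2.
set f1 := mixed u v c s1 s in ih1.
have vjL := vL j jt.
have f1L : Lvec mu r f1.
  move=> i; have it : i \in (s1 :|: s)%SET -> v i \in Lr.
    by move=> is_; apply: vL; exact: (fintype.subsetP s1t).
  rewrite /f1 /mixed; have [is1|nis1] := boolP (i \in s1).
    by apply: Lfun_lin => //; apply: it; rewrite finset.in_setU is1.
  have [is_|nis] := boolP (i \in s); last exact: uL.
  by apply: it; rewrite finset.in_setU is_ orbT.
have f1j : f1 j = u j.
  by apply/funext => y; rewrite /f1 /mixed !inE eqxx/= (negbTE js).
pose f2 : vfun := dfwith f1 j (fun y => c j * f1 j y).
have f2L : Lvec mu r f2.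
  by apply: Lvec_dfwith => //; apply: Lfun_scale_r => //; exact: f1L.
have e1 : mixed u v c s0 s = dfwith f2 j (f2 j \+ v j).
  apply/funext => i; have [->|ij] := eqVneq i j.
    by rewrite dfwithin /f2 dfwithin f1j; apply/funext => y; rewrite /mixed js0.
  rewrite dfwithout 1?eq_sym// /f2 dfwithout 1?eq_sym//.
  by apply/funext => y; rewrite /f1 /mixed !inE ij.
have e2 : mixed u v c s1 (j |: s)%SET = dfwith f2 j (v j).
  apply/funext => i; have [->|ij] := eqVneq i j.
    by rewrite dfwithin; apply/funext => y; rewrite /mixed !inE eqxx.
  rewrite dfwithout 1?eq_sym// /f2 dfwithout 1?eq_sym//.
  by apply/funext => y; rewrite /f1 /mixed !inE (negbTE ij).
rewrite e1; have [_ /(_ _ vjL x) TD] := sT f2 j f2L.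
apply: le_trans TD _; rewrite -e2.
have [/(_ (c j) x) TZ _] := sT f1 j f1L; rewrite -/f2 in TZ; rewrite TZ.
apply: le_trans (lerD (ler_wpM2l (normr_ge0 _) ih1) ih2) _.
rewrite (bigD1 j)//= [X in _ + K * X](bigD1 j)//= [X in _ <= K * X](bigD1 j)//=.
rewrite js0 !inE eqxx/= (negbTE js).
set P := \prod_(i < m | i != j) _.
set P' := \prod_(i < m | i != j) _.
set P'' := \prod_(i < m | i != j) _.
have -> : P = P'' by apply: eq_bigr => i ij; rewrite !inE ij.
have -> : P' = P'' by apply: eq_bigr => i ij; rewrite !inE ij (negbTE ij).
by rewrite le_eqVlt; apply/orP; left; apply/eqP; ring.
Qed.

Lemma lee_prod_EFin (e : 'I_m -> \bar R) (w : 'I_m -> R) :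
  (forall i, (0 <= e i <= (w i)%:E)%E) ->
  (\prod_(i < m) e i <= (\prod_(i < m) w i)%:E)%E.
Proof.
move=> H; have eE i : e i = (fine (e i))%:E.
  have /andP[e0 ew] := H i; rewrite fineK// ge0_fin_numE//.
  by apply: le_lt_trans ew _; rewrite ltry.
under eq_bigr do rewrite eE; rewrite prodEFin lee_fin.
apply: ler_prod => i _; have := H i.
by rewrite eE !lee_fin.
Qed.

End sublinear_operators.
(** * One step of the domination *)

Section step.
Context d (X : measurableType d) (R : realType).
Context (mu : {measure set X -> \bar R}) (ball : set (set X)).
Context (star : set X -> set X) (C0 : R).
Context (bb : ball_basis mu ball star C0) (r : R) (r_ge1 : 1 <= r).
Context (m : nat) (m_gt0 : (0 < m)%N).
Local Notation sz A := (fine (mu A)).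
Local Notation Lr := (Lfun mu r%:E).
Local Notation powint := (powint mu r).
Local Notation avg := (avg mu r).
Local Notation vfun := ('I_m -> X -> R).

Lemma card_sets_ord : #|{: {set 'I_m}}| = (2 ^ m)%N.
Proof. by rewrite -finset.cardsT -powersetT card_powerset finset.cardsT card_ord. Qed.

Lemma measure_finite_union (I : finType) (F : I -> set X) (c : R) : 0 <= c ->
  (forall i, measurable (F i)) -> (forall i, (mu (F i) <= c%:E)%E) ->
  exists U, [/\ measurable U, forall i, F i `<=` U &
                (mu U <= (#|I|%:R * c)%:E)%E].
Proof.
move=> c0 mF Fc.
suff gen (s : seq I) : exists U, [/\ measurable U,
    forall i, i \in s -> F i `<=` U & (mu U <= ((size s)%:R * c)%:E)%E].
  have [U [mU FU muU]] := gen (enum I); exists U; split=> //.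
    by move=> i; apply: FU; rewrite mem_enum.
  by rewrite cardE.
elim: s => [|i s [U [mU FU muU]]].
  by exists set0; split=> //; rewrite measure0 mul0r.
exists (F i `|` U); split; first exact: measurableU.
  move=> j; rewrite in_cons => /predU1P[->|/FU FjU]; first exact: subsetUl.
  by apply: subset_trans FjU _; exact: subsetUr.
apply: le_trans (measureU2 _ (mF i) mU) _.
rewrite /= -natr1 mulrDl mul1r addrC EFinD; exact: leeD.
Qed.

(** The stopping balls of an exceptional set have twice its measure at most, so
    this is half of the ratio that [sparse_selection] requires. *)
Definition node_density : R := (96 * C0 ^+ 11)^-1.
(** With the two levels below, the exceptional set of a node [Z] consists of
    [2 ^ m] level sets of the operator and at most [2 m] of maximal functions,
    the two kinds sharing [node_density] equally; the power of [C0] contains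
    the ratio [C0 ^ 3] between the measures of [Z] and of its triple star. *)
Definition node_level : R := 384 * 2 ^+ m * C0 ^+ 14.
Definition maximal_level : R := 768 * m%:R * C0 ^+ 15.
(** Here [2 ^ m] level sets must fill at most a quarter of a ball, in terms of
    the measure of its star. *)
Definition jump_level : R := 4 * 2 ^+ m * C0.
Definition step_const : R := node_level ^+ m
  + (jump_level * maximal_level) ^+ m + 2 * (4 * maximal_level) ^+ m.

Let C0_1 : 1 <= C0 := ball_C0_ge1 bb.
Let C0n n : 1 <= C0 ^+ n. Proof. exact: exprn_ege1. Qed.
Let two_m : 1 <= 2 ^+ m :> R. Proof. by apply: exprn_ege1; rewrite ler1n. Qed.
Let mR : 1 <= m%:R :> R. Proof. by rewrite ler1n. Qed.

Lemma node_level_ge1 : 1 <= node_level.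
Proof. by rewrite /node_level; have := C0n 14; have := two_m; nra. Qed.

Lemma maximal_level_ge1 : 1 <= maximal_level.
Proof. by rewrite /maximal_level; have := C0n 15; have := mR; nra. Qed.

Lemma jump_level_ge1 : 1 <= jump_level.
Proof. by rewrite /jump_level; have := two_m; have := C0_1; nra. Qed.

Lemma step_const_gt0 : 0 < step_const.
Proof.
have h1 := exprn_ege1 m node_level_ge1.
have h2 : 1 <= (jump_level * maximal_level) ^+ m.
  by apply: exprn_ege1; apply: mulr_ege1; [exact: jump_level_ge1|exact: maximal_level_ge1].
have h3 : 1 <= (4 * maximal_level) ^+ m.
  by apply: exprn_ege1; have := maximal_level_ge1; lra.
rewrite /step_const; lra.
Qed.

Context (T : vfun -> X -> R) (CT : R) (CT_gt0 : 0 < CT).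
Context (wT : weak_bound mu r T CT).
Context (mT : forall g, Lvec mu r g -> measurable_fun setT (T g)).
Context (subT : multisublinear mu r T).
Context (b f : vfun) (tau : {set 'I_m}).
Context (fL : forall i, f i \in Lr).
Context (bfL : forall i, i \in tau -> (fun y => b i y * f i y) \in Lr).

Definition oscil (c : 'I_m -> R) : vfun := fun i y => (c i - b i y) * f i y.

Lemma oscil_Lfun c i : i \in tau -> oscil c i \in Lr.
Proof.
move=> it; have -> : oscil c i = (fun y => c i * f i y + (-1) * (b i y * f i y)).
  by apply/funext => y; rewrite /oscil; ring.
by apply: Lfun_lin => //; apply: Lfun_scale_r => //; exact: bfL.
Qed.

Definition cut (c : 'I_m -> R) (H : set X) (s : {set 'I_m}) : vfun :=
  mixed (vindic f H) (vindic (oscil c) H) (fun=> 0) finset.set0 s.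

Lemma cutE c H s i : cut c H s i = (if i \in s then oscil c i else f i) \* \1_H.
Proof.
by apply/funext => y; rewrite /cut /mixed finset.in_set0; case: ifP.
Qed.

Lemma cut_Lvec c H (s : {set 'I_m}) : measurable H -> s \subset tau ->
  Lvec mu r (cut c H s).
Proof.
move=> mH st i; rewrite cutE; apply: Lfun_restrict => //.
case: ifPn => is_ //; apply: oscil_Lfun; exact: (fintype.subsetP st).
Qed.

(** The argument of the commutator depends on the point [x], but only through
    the coefficients of the fixed functions [f i] and [oscil c i]. *)
Lemma comm_arg_mixed c H x (t : {set 'I_m}) :
  vindic (commutator_arg b (fun i => i \in t) f x) H =
  mixed (vindic f H) (vindic (oscil c) H) (fun i => b i x - c i) t finset.set0.
Proof.
apply/funext => i; apply/funext => y.
rewrite /vindic /commutator_arg /mixed /oscil finset.in_set0 /=.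
by case: ifP => _; [rewrite expr1; ring|rewrite expr0 mul1r].
Qed.

Lemma comm_arg_Lvec (t : {set 'I_m}) x : t \subset tau ->
  Lvec mu r (commutator_arg b (fun i => i \in t) f x).
Proof.
move=> tt i; have [it|it] := boolP (i \in t).
  have -> : commutator_arg b (fun i => i \in t) f x i =
      (fun y => b i x * f i y + (-1) * (b i y * f i y)).
    by apply/funext => y; rewrite /commutator_arg it expr1; ring.
  apply: Lfun_lin => //; apply: Lfun_scale_r => //; apply: bfL.
  exact: (fintype.subsetP tt).
have -> : commutator_arg b (fun i => i \in t) f x i = f i => //.
by apply/funext => y; rewrite /commutator_arg (negbTE it) expr0 mul1r.
Qed.

(** The factor contributed by the entry [i] to the sparse bound, before
    expansion over the pairs of subsets of [t]. *)
Definition weight (c U V : 'I_m -> R) (t : {set 'I_m}) x i : R :=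
  if i \in t then `|b i x - c i| * U i + V i else U i.

Lemma comm_arg_bound c H (U V : 'I_m -> R) (K : R) (t : {set 'I_m}) x x' :
  measurable H -> t \subset tau ->
  (forall s : {set 'I_m}, s \subset tau ->
    `|T (cut c H s) x'| <= K * \prod_i (if i \in s then V i else U i)) ->
  `|T (vindic (commutator_arg b (fun i => i \in t) f x) H) x'|
    <= K * \prod_i weight c U V t x i.
Proof.
move=> mH tt HK; rewrite (comm_arg_mixed c).
apply: (sublinear_mixed r_ge1 subT).
- by move=> i; exact: Lfun_restrict.
- move=> i it; apply: Lfun_restrict => //; apply: oscil_Lfun.
  exact: (fintype.subsetP tt).
- move=> s st; have := HK s (fintype.subset_trans st tt).
  congr (`|T _ _| <= _); apply/funext => i; apply/funext => y.
  by rewrite /cut /mixed finset.in_set0.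
Qed.

Definition good_node (c U V : 'I_m -> R) (H F : set X) :=
  (forall x, ~ F x -> forall s : {set 'I_m}, s \subset tau ->
    `|T (cut c H s) x| <= node_level ^+ m * CT *
       \prod_i (if i \in s then V i else U i)) /\
  (forall x B, ~ F x -> ball B -> B x -> forall i,
    avg B (f i \* \1_H) <= maximal_level * U i /\
    (i \in tau -> avg B (oscil c i \* \1_H) <= maximal_level * V i)).

(** The mass of the data on [H] is comparable with that on the triple star of
    [Z], so that averages over the latter are the right levels for the weak
    type bounds of the operator and of the maximal functions. *)
Lemma exceptional_set c (Z H : set X) : ball Z -> measurable H ->
  let D := iter 3 star Z in
  (forall i, (powint setT (f i \* \1_H)%R <= 2%:E * powint D (f i))%E) ->
  (forall i, i \in tau ->
    (powint setT (oscil c i \* \1_H)%R <= 2%:E * powint D (oscil c i))%E) ->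
  exists2 F, measurable F & (mu F <= node_density%:E * mu Z)%E /\
    good_node c (fun i => avg D (f i)) (fun i => avg D (oscil c i)) H F.
Proof.
move=> bZ mH D concf conco.
have bD : ball D := iter_star_ball bb 3 bZ.
have mD := ball_measurable bb bD.
have sD := ball_size_gt0 bb bD; have sZ := ball_size_gt0 bb bZ.
have C0p := C0_gt0 bb.
have DZ : sz D <= C0 ^+ 3 * sz Z := iter_star_size bb 3 bZ.
pose U i := avg D (f i); pose V i := avg D (oscil c i).
have concf' i : (powint setT (f i \* \1_H)%R <= (2 * U i `^ r * sz D)%:E)%E.
  by have := concf i; have [_ ->] := avgE r_ge1 mD sD (fL i); rewrite -EFinM mulrA.
have conco' i : i \in tau ->
    (powint setT (oscil c i \* \1_H)%R <= (2 * V i `^ r * sz D)%:E)%E.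
  move=> it; have := conco i it.
  by have [_ ->] := avgE r_ge1 mD sD (oscil_Lfun c it); rewrite -EFinM mulrA.
pose a (s : {set 'I_m}) i := if i \in s then V i else U i.
have a0 s i : 0 <= a s i by rewrite /a; case: ifP => _; exact: avg_ge0.
pose Fw (s : {set 'I_m}) := if s \subset tau then
  [set x | node_level ^+ m * CT * \prod_i a s i < `|T (cut c H s) x|] else set0.
have nl0 : 0 < node_level := lt_le_trans ltr01 node_level_ge1.
have M0 : 0 <= 2 * sz D := mulr_ge0 (ler0n R 2) (ltW sD).
have Kw0 : 0 <= node_level^-1 * (2 * sz D).
  by rewrite mulr_ge0// invr_ge0 ltW.
have Fw_small s : measurable (Fw s) /\ (mu (Fw s) <= (node_level^-1 * (2 * sz D))%:E)%E.
  rewrite /Fw; case: ifPn => st; last first.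
    by split=> //; rewrite measure0 lee_fin.
  have cL := cut_Lvec c mH st; split.
    exact: measurable_abs_gt (mT cL).
  apply: (weak_level_set r_ge1 m_gt0 CT_gt0 wT (mT cL) cL node_level_ge1 M0 (a0 s)).
  move=> i; rewrite cutE /a; case: ifPn => is_; last first.
      by apply: le_trans (concf' i) _; rewrite lee_fin mulrCA mulrA.
    apply: le_trans (conco' i _) _; first exact: (fintype.subsetP st).
    by rewrite lee_fin mulrCA mulrA.
have [Uw [mUw FUw muUw]] := measure_finite_union Kw0
  (fun s => (Fw_small s).1) (fun s => (Fw_small s).2).
have ml0 : 0 < maximal_level := lt_le_trans ltr01 maximal_level_ge1.
pose ex_small (e : R) (P : set X -> Prop) :=
  exists W, [/\ measurable W, (mu W <= e%:E)%E & P W].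
pose e := 2 * C0 / maximal_level * sz D.
have e0 : 0 <= e.
  by rewrite /e mulr_ge0 ?(ltW sD)// divr_ge0 ?(ltW ml0)// mulr_ge0// ltW.
have [Wf Wfm] := choice (fun i => maximal_bound bb r_ge1
  (Lfun_restrict r_ge1 mH (fL i)) (avg_ge0 mu r D (f i)) maximal_level_ge1 sD (concf' i)).
have [Uf [mUf FUf muUf]] := measure_finite_union e0
    (fun i => let: And3 p _ _ := Wfm i in p) (fun i => let: And3 _ p _ := Wfm i in p).
have exo i : ex_small e (fun W => i \in tau -> forall x B, ~ W x -> ball B -> B x ->
    avg B (oscil c i \* \1_H) <= maximal_level * V i).
  have [it|it] := boolP (i \in tau); last first.
    by exists set0; split=> //; rewrite measure0 lee_fin.
  have [W [mW muW HW]] := maximal_bound bb r_ge1 (Lfun_restrict r_ge1 mH (oscil_Lfun c it))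
    (avg_ge0 mu r D (oscil c i)) maximal_level_ge1 sD (conco' i it).
  by exists W.
have [Wo Wom] := choice exo.
have [Uo [mUo FUo muUo]] := measure_finite_union e0
    (fun i => let: And3 p _ _ := Wom i in p) (fun i => let: And3 _ p _ := Wom i in p).
exists (Uw `|` (Uf `|` Uo)); first by do 2 apply: measurableU => //.
split; last split.
- apply: le_trans (measureU2 _ mUw (measurableU _ _ mUf mUo)) _.
  apply: le_trans (leeD muUw (le_trans (measureU2 _ mUf mUo) (leeD muUf muUo))) _.
  rewrite (ball_muE bb bZ) -!(EFinM, EFinD) lee_fin.
  rewrite card_sets_ord card_ord natrX /e.
  have -> : 2 ^+ m * (node_level^-1 * (2 * sz D)) + (m%:R * (2 * C0 / maximal_level * sz D)
      + m%:R * (2 * C0 / maximal_level * sz D)) = (96 * C0 ^+ 14)^-1 * sz D.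
    rewrite /node_level /maximal_level; field.
    have m0R : (m%:R : R) != 0 by rewrite gt_eqF// ltr0n.
    by rewrite m0R (gt_eqF C0p) expf_neq0//.
  apply: le_trans (ler_wpM2l _ DZ) _.
    by rewrite invr_ge0 mulr_ge0// exprn_ge0// ltW.
  rewrite le_eqVlt; apply/orP; left; apply/eqP; rewrite /node_density; field.
  by rewrite gt_eqF.
- move=> x nF s st; rewrite leNgt; apply/negP => h; apply: nF; left.
  by apply: (FUw s); rewrite /Fw st.
- move=> x B nF bB Bx i; split.
    have [_ _ HW] := Wfm i; apply: (HW x B _ bB Bx) => Wx.
    by apply: nF; right; left; exact: (FUf i).
  move=> it; have [_ _ /(_ it) HW] := Wom i; apply: (HW x B _ bB Bx) => Wx.
  by apply: nF; right; right; exact: (FUo i).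
Qed.

(** Where the exceptional set has density at most one half, some good point
    is also good for the data cut off to [star B], by the weak type bound. *)
Lemma good_point c (H F B : set X) : measurable H -> measurable F -> ball B ->
  (2%:E * mu (B `&` F) <= mu B)%E ->
  exists x, [/\ B x, ~ F x & forall s : {set 'I_m}, s \subset tau ->
    `|T (vindic (cut c H s) (star B)) x|
      <= jump_level ^+ m * CT * \prod_i avg (star B) (cut c H s i)].
Proof.
move=> mH mF bB FB.
have bS := star_ball bb bB; have mS := ball_measurable bb bS.
have sS := ball_size_gt0 bb bS; have sB := ball_size_gt0 bb bB.
have C0p := C0_gt0 bb; have mB := ball_measurable bb bB.
have jl0 : 0 < jump_level := lt_le_trans ltr01 jump_level_ge1.
pose a (s : {set 'I_m}) i := avg (star B) (cut c H s i).
pose E (s : {set 'I_m}) := if s \subset tau then [set x |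
  jump_level ^+ m * CT * \prod_i a s i < `|T (vindic (cut c H s) (star B)) x|]
  else set0.
have K0 : 0 <= jump_level^-1 * sz (star B).
  by apply: mulr_ge0; [rewrite invr_ge0 ltW|exact: ltW].
have E_small s : measurable (E s) /\ (mu (E s) <= (jump_level^-1 * sz (star B))%:E)%E.
  rewrite /E; case: ifPn => st; last by split=> //; rewrite measure0 lee_fin.
  have cL := cut_Lvec c mH st.
  have gL : Lvec mu r (vindic (cut c H s) (star B)).
    by move=> i; apply: Lfun_restrict => //; exact: cL.
  split; first exact: measurable_abs_gt (mT gL).
  apply: (weak_level_set r_ge1 m_gt0 CT_gt0 wT (mT gL) gL jump_level_ge1 (ltW sS)).
    by move=> i; exact: avg_ge0.
  move=> i; rewrite /vindic powint_restrict// setTI.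
  by have [_ ->] := avgE r_ge1 mS sS (cL i).
have [U [mU EU muU]] := measure_finite_union K0
  (fun s => (E_small s).1) (fun s => (E_small s).2).
have {}muU : (mu U <= (4^-1 * sz B)%:E)%E.
  apply: le_trans muU _; rewrite lee_fin.
  rewrite card_sets_ord natrX mulrA; apply: le_trans (ler_wpM2l _ (star_size bb bB)) _.
    by rewrite mulr_ge0 ?exprn_ge0// invr_ge0 ltW.
  rewrite le_eqVlt; apply/orP; left; apply/eqP; rewrite /jump_level; field.
  by rewrite (gt_eqF C0p) expf_neq0// pnatr_eq0.
have [[x [Bx nF nU]]|no] := pselect (exists x, [/\ B x, ~ F x & ~ U x]).
  exists x; split=> // s st; rewrite leNgt; apply/negP => h; apply: nU.
  by apply: (EU s); rewrite /E st.
exfalso; have BFU : B `<=` (B `&` F) `|` U.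
  move=> x Bx; have [Fx|nF] := pselect (F x); first by left.
  by right; apply: contrapT => nU; apply: no; exists x.
have mBF : measurable (B `&` F) by exact: measurableI.
have muB : (mu B <= mu (B `&` F) + (4^-1 * sz B)%:E)%E.
  apply: le_trans (leeD2l _ muU); apply: le_trans (measureU2 _ mBF mU).
  by apply: le_measure => //; apply/mem_set => //; exact: measurableU.
have fBF : mu (B `&` F) \is a fin_num.
  rewrite ge0_fin_numE//; apply: le_lt_trans (_ : (mu B < +oo)%E).
    by apply: le_measure; [exact/mem_set|exact/mem_set|exact: subIsetl].
  by rewrite (ball_muE bb bB) ltry.
move: FB muB; rewrite (ball_muE bb bB) -(fineK fBF) -EFinM -EFinD !lee_fin.
lra.
Qed.

Context (W : normedModType R) (Tv : vfun -> X -> W) (C1 C2 : R).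
Context (C1_gt0 : 0 < C1) (C2_gt0 : 0 < C2) (C1T : C1 <= CT) (C2T : C2 <= CT).
Context (nT : forall g, Lvec mu r g -> forall x, `|T g x| = `|Tv g x|).
Context (T1 : oscillation_T1 mu ball star r Tv C1).
Context (T2 : oscillation_T2 mu ball star r Tv C2).

Lemma avg_comm_arg_le c U V H F (t : {set 'I_m}) x x' B i :
  measurable H -> good_node c U V H F -> (forall i, 0 <= U i) ->
  (forall i, 0 <= V i) -> t \subset tau -> ball B -> B x' -> ~ F x' ->
  (0 <= avg_r mu r B (vindic (commutator_arg b (fun i => i \in t) f x) H i)
     <= (4 * maximal_level * weight c U V t x i)%:E)%E.
Proof.
move=> mH [_ good] U0 V0 tt bB Bx' nF.
have [mB sB] := (ball_measurable bb bB, ball_size_gt0 bb bB).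
have [avf avo] := good _ _ nF bB Bx' i.
have fHL i0 : f i0 \* \1_H \in Lr by exact: Lfun_restrict.
have ml0 : 0 < maximal_level := lt_le_trans ltr01 maximal_level_ge1.
rewrite (comm_arg_mixed c) /mixed /weight; have [it|it] := boolP (i \in t).
  have oL : oscil c i \* \1_H \in Lr.
    by apply: Lfun_restrict => //; apply: oscil_Lfun; exact: (fintype.subsetP tt).
  have sumL := Lfun_lin r_ge1 (b i x - c i) (fHL i) oL.
  have [-> _] := avgE r_ge1 mB sB sumL.
  rewrite !lee_fin avg_ge0/=.
  apply: le_trans (avg_lin_le r_ge1 (b i x - c i) mB sB (fHL i) oL) _.
  rewrite -mulrA ler_wpM2l// mulrDr.
  apply: lerD; last by apply: avo; exact: (fintype.subsetP tt).
  by rewrite mulrCA ler_wpM2l.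
rewrite finset.in_set0; have [-> _] := avgE r_ge1 mB sB (fHL i).
rewrite !lee_fin avg_ge0/=; apply: le_trans avf _.
have h41 : 1 <= 4 :> R by rewrite ler1n.
by rewrite -mulrA; exact: ler_peMl (mulr_ge0 (ltW ml0) (U0 i)) h41.
Qed.

(** The operator is localized from [H] to [star P].  The first oscillation
    condition provides a ball [B] strictly containing [P] and allows passing
    from [star B] to [star P]; the second one, on [B], allows passing from [H]
    to [star B] at the cost of the values at one more point [x'], taken outside
    the exceptional set.  The maximal functions at [x'] bound the averages over
    all balls containing [B], hence also the right-hand sides of both
    conditions. *)
Lemma step_bound c (U V : 'I_m -> R) (H F P : set X) (t : {set 'I_m}) x :
  measurable H -> measurable F -> good_node c U V H F ->
  (forall i, 0 <= U i) -> (forall i, 0 <= V i) ->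
  ball P -> star P `<=` H ->
  (forall B, ball B -> P `<` B -> (2%:E * mu (B `&` F) <= mu B)%E) ->
  t \subset tau -> P x ->
  `|T (vindic (commutator_arg b (fun i => i \in t) f x) H) x|
    <= step_const * CT * \prod_i weight c U V t x i
       + `|T (vindic (commutator_arg b (fun i => i \in t) f x) (star P)) x|.
Proof.
move=> mH mF good U0 V0 bP PH nondense tt Px.
set g := commutator_arg b (fun i => i \in t) f x.
set w := weight c U V t x.
have w0 i : 0 <= w i.
  rewrite /w /weight; case: ifP => _ //.
  by rewrite addr_ge0// mulr_ge0.
have prodw0 : 0 <= \prod_i w i by apply: prodr_ge0.
have vindicI E1 E2 : vindic (vindic g E1) E2 = vindic g (E1 `&` E2).
  apply/funext => i; apply/funext => y; rewrite /vindic /= indicI /=.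
  by rewrite mulrA.
have [PT|PT] := pselect (star P = setT).
  have -> : H = star P by apply/seteqP; split=> // y _; rewrite PT.
  rewrite lerDr mulr_ge0// mulr_ge0// ltW//; exact: step_const_gt0.
have sP : star P `<` setT.
  by split=> // h; apply: PT; apply/seteqP; split.
have [B [bB PB T1B]] := T1 bP sP.
have [x' [Bx' nFx' jumpx']] := good_point c mH mF bB (nondense B bB PB).
have bS := star_ball bb bB; have mS := ball_measurable bb bS.
have gL : Lvec mu r g by exact: comm_arg_Lvec.
have gHL : Lvec mu r (vindic g H).
  by move=> i; apply: Lfun_restrict => //; exact: gL.
have gHSL : Lvec mu r (vindic (vindic g H) (star B)).
  by move=> i; apply: Lfun_restrict => //; exact: gHL.
have mP := ball_measurable bb (star_ball bb bP).
have gPE : vindic (vindic g H) (star P) = vindic g (star P).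
  by rewrite vindicI; congr vindic; apply/setIidPr.
have gPL : Lvec mu r (vindic g (star P)).
  by move=> i; apply: Lfun_restrict => //; exact: gL.
have ml0 : 0 < maximal_level := lt_le_trans ltr01 maximal_level_ge1.
have Sx' : star B x' by exact: (sub_star bb bB).
have prod_const K : \prod_i (K * w i) = K ^+ m * \prod_i w i.
  by rewrite big_split/= prodr_const card_ord.
have avgle A : ball A -> A x' -> forall i,
    (0 <= avg_r mu r A (vindic g H i) <= (4 * maximal_level * w i)%:E)%E.
  by move=> bA Ax' i; exact: (avg_comm_arg_le x i mH good U0 V0 tt bA Ax' nFx').
have step1 : `|Tv (vindic (vindic g H) (star B)) x - Tv (vindic g (star P)) x|
    <= CT * ((4 * maximal_level) ^+ m * \prod_i w i).
  rewrite -lee_fin; apply: le_trans (_ : (_ <= C1%:E * \prod_(i < m)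
     avg_r mu r (star B) (vindic g H i))%E) _.
    rewrite -gPE; apply: le_trans (T1B _ gHL); apply: ereal_sup_ubound.
    by exists x.
  rewrite EFinM; apply: lee_pmul => //.
  - by rewrite lee_fin ltW.
  - by apply: prode_ge0 => i _; exact: poweR_ge0.
  - rewrite -prod_const; apply: lee_prod_EFin => i; exact: avgle.
have step2 : `|(Tv (vindic g H) x - Tv (vindic (vindic g H) (star B)) x)
      - (Tv (vindic g H) x' - Tv (vindic (vindic g H) (star B)) x')|
    <= CT * ((4 * maximal_level) ^+ m * \prod_i w i).
  rewrite -lee_fin; apply: le_trans (_ : (_ <= C2%:E * \prod_(i < m)
     sup_avg_r mu ball r B (vindic g H i))%E) _.
    apply: le_trans (T2 bB gHL); apply: ereal_sup_ubound.
    exists x; first by case: PB => + _; apply.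
    by exists x'.
  have sup0 i : (0 <= sup_avg_r mu ball r B (vindic g H i))%E.
    apply: le_trans (_ : (avg_r mu r B (vindic g H i) <= _)%E).
      exact: poweR_ge0.
    by apply: ereal_sup_ubound; exists B => //; split.
  rewrite EFinM; apply: lee_pmul => //.
  - by rewrite lee_fin ltW.
  - by apply: prode_ge0 => i _; exact: sup0.
  - rewrite -prod_const; apply: lee_prod_EFin => i; rewrite sup0/=.
    apply: ge_ereal_sup => _ [A [bA BA] <-].
    by have /andP[_ ->] := avgle A bA (BA _ Bx') i.
have step3 : `|T (vindic g H) x'| <= node_level ^+ m * CT * \prod_i w i.
  by apply: comm_arg_bound => // s st; have [h _] := good; exact: h.
have step4 : `|T (vindic (vindic g H) (star B)) x'|
    <= (jump_level * maximal_level) ^+ m * CT * \prod_i w i.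
  rewrite vindicI; apply: comm_arg_bound => //; first exact: measurableI.
  move=> s st; have := jumpx' s st.
  have -> : vindic (cut c H s) (star B) = cut c (H `&` star B) s.
    apply/funext => i; rewrite /vindic !cutE indicI.
    by apply/funext => y /=; rewrite mulrA.
  move/le_trans; apply.
  have jC0 : 0 <= jump_level ^+ m * CT.
    by rewrite mulr_ge0 ?(ltW CT_gt0)// exprn_ge0// (le_trans ler01 jump_level_ge1).
  have -> : (jump_level * maximal_level) ^+ m * CT *
      \prod_i (if i \in s then V i else U i) = jump_level ^+ m * CT *
      \prod_i (maximal_level * (if i \in s then V i else U i)).
    by rewrite big_split/= prodr_const card_ord exprMn; ring.
  apply: (ler_wpM2l jC0); apply: ler_prod => i _; rewrite avg_ge0/= cutE.
  have [_ /(_ x' _ nFx' bS Sx' i) [h1 h2]] := good.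
  case: ifPn => is_ //; apply: h2; exact: (fintype.subsetP st).
rewrite (nT gPL) (nT gHL).
rewrite (nT gHL) in step3; rewrite (nT gHSL) in step4.
move: step1 step2 step3 step4.
set a := Tv (vindic g H) x; set a' := Tv (vindic g H) x'.
set e := Tv (vindic (vindic g H) (star B)) x.
set e' := Tv (vindic (vindic g H) (star B)) x'.
set p := Tv _ x => step1 step2 step3 step4.
(* pass from H to star B through the point x', then from star B to star P *)
have aE : a = (((a - e) - (a' - e')) + (a' - e')) + ((e - p) + p).
  by rewrite subrK subrK subrK.
rewrite {1}aE; apply: le_trans (ler_normD _ _) _.
apply: le_trans (lerD (ler_normD _ _) (ler_normD _ _)) _.
have h := ler_normB a' e'.
rewrite /step_const; move: step1 step2 step3 step4 h.
move: (`|_ - _ - _|) (`|a' - e'|) (`|e - p|) `|p| `|a'| `|e'| => n1 n2 n3 n4 n5 n6.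
move: (node_level ^+ m) (_ ^+ m) (_ ^+ m) (\prod_i w i) => k1 k2 k3 k4.
nra.
Qed.

Lemma stop_bound c (U V : 'I_m -> R) (H F : set X) (t : {set 'I_m}) x :
  measurable H -> good_node c U V H F ->
  (forall i, 0 <= U i) -> (forall i, 0 <= V i) -> t \subset tau -> ~ F x ->
  `|T (vindic (commutator_arg b (fun i => i \in t) f x) H) x|
    <= step_const * CT * \prod_i weight c U V t x i.
Proof.
move=> mH [good _] U0 V0 tt nF.
have w0 i : 0 <= weight c U V t x i.
  by rewrite /weight; case: ifP => _ //; rewrite addr_ge0// mulr_ge0.
apply: le_trans (comm_arg_bound (K := node_level ^+ m * CT) x mH tt _) _.
  by move=> s st; exact: good.
apply: ler_wpM2r; first exact: prodr_ge0.
apply: ler_wpM2r; first exact: ltW.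
have ml0 : 0 <= maximal_level := le_trans ler01 maximal_level_ge1.
have jl0 : 0 <= jump_level := le_trans ler01 jump_level_ge1.
rewrite /step_const -addrA lerDl addr_ge0//; first by rewrite exprn_ge0// mulr_ge0.
by rewrite mulr_ge0// exprn_ge0// mulr_ge0.
Qed.

(** * Chains of nested balls and the sparse bound *)

Local Notation star3 := (iter 3 star).

Context (Q : set X) (bQ : ball Q).
Context (concf : forall i, (powint setT (f i) <= 2%:E * powint Q (f i))%E).
Context (conco : forall i c, i \in tau ->
  (powint setT (fun x => ((b i x - c) * f i x)%R)
     <= 2%:E * powint Q (fun x => ((b i x - c) * f i x)%R))%E).

Definition center (D : set X) i : R := mean mu D (b i).

Definition ball_weight (D : set X) (t : {set 'I_m}) x i : R :=
  weight (center D) (fun i => avg D (f i)) (fun i => avg D (oscil (center D) i)) t x i.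

(** The data are localized to the triple star of each node but the root, where
    the full data are kept, being concentrated in [Q]. *)
Definition node_domain (Z : set X) : set X := if Z == Q then setT else star3 Z.

Lemma ball_weight_ge0 D t x i : 0 <= ball_weight D t x i.
Proof.
rewrite /ball_weight /weight; case: ifP => _; last exact: avg_ge0.
by rewrite addr_ge0 ?mulr_ge0 ?avg_ge0.
Qed.

Lemma powint_oscil B c i :
  powint B (oscil c i) = powint B (fun x => (b i x - c i) * f i x).
Proof. by apply: eq_integral => x _; rewrite /oscil !normrM distrC. Qed.

Lemma node_domain_measurable Z : ball Z -> measurable (node_domain Z).
Proof.
move=> bZ; rewrite /node_domain; case: ifP => // _.
exact: (ball_measurable bb (iter_star_ball bb 3 bZ)).
Qed.

Lemma node_concentrated Z (g : X -> R) : ball Z -> g \in Lr ->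
  (powint setT g <= 2%:E * powint Q g)%E ->
  (powint setT (g \* \1_(node_domain Z))%R <= 2%:E * powint (star3 Z) g)%E.
Proof.
move=> bZ gL concg; have mg := Lfun_measurable gL.
have mD := ball_measurable bb (iter_star_ball bb 3 bZ).
rewrite powint_restrict// setTI /node_domain; case: ifPn => [/eqP ZQ|_].
  apply: le_trans concg _; rewrite lee_pmul2l// -ZQ.
  apply: powint_subset => //; first exact: (ball_measurable bb bZ).
  exact: (sub_iter_star bb 3 bZ).
by rewrite -[leLHS]mul1e lee_wpmul2r ?powint_ge0// lee_fin ler1n.
Qed.

Lemma node_exceptional Z : exists F, ball Z ->
  [/\ measurable F, (mu F <= node_density%:E * mu Z)%E &
  good_node (center (star3 Z)) (fun i => avg (star3 Z) (f i))
    (fun i => avg (star3 Z) (oscil (center (star3 Z)) i)) (node_domain Z) F].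
Proof.
have [bZ|nbZ] := pselect (ball Z); last by exists set0.
have [|i it|F mF [muF goodF]] := @exceptional_set (center (star3 Z)) Z
    (node_domain Z) bZ (node_domain_measurable bZ).
- by move=> i; apply: node_concentrated => //; exact: concf.
- apply: node_concentrated => //; first exact: oscil_Lfun.
  by rewrite !powint_oscil; exact: conco.
by exists F.
Qed.

Lemma esum_ge_seq (I : set (set X)) (l : seq (set X)) (phi : set X -> \bar R) :
  uniq l -> (forall D, D \in l -> I D) -> (forall D, (0 <= phi D)%E) ->
  (\sum_(D <- l) phi D <= \esum_(D in I) phi D)%E.
Proof.
move=> ul lI phi0; apply: esum_ge; exists [set` l]; first by split=> [|D /= /lI//]; exact: finite_seq.
by rewrite -fsbig_seq.
Qed.

(** Starting at the root, each point lying in the exceptional set of the current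
    node is moved on to a selected ball [Y] replacing one of the stopping balls
    of that node.  Almost every point lies in the double stars of balls of
    finitely many levels only, so its chain is finite; along it the triple
    stars decrease strictly, hence are distinct members of the sparse
    family. *)
Lemma chain_domination : exists (S : set (set X)) (lv : set X -> nat),
  [/\ S `<=` ball,
   (forall Y Y', S Y -> S Y' -> lv Y = lv Y' -> Y `&` Y' !=set0 -> Y = Y'),
   (\esum_(A in S) mu A < +oo)%E,
   forall Y, S Y ->
     (\esum_(A in [set A | [/\ S A, A `&` Y !=set0 & ((lv Y).+2 <= lv A)%N]]) mu A
       <= 2^-1%:E * mu Y)%E &
   mu.-negligible [set x | Q x /\ ~ exists l : seq (set X), [/\ uniq l,
     forall D, D \in l -> D x /\ exists2 Y, S Y & D = star3 Y &
     forall t : {set 'I_m}, t \subset tau ->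
       `|T (commutator_arg b (fun i => i \in t) f x) x|
         <= step_const * CT * \sum_(D <- l) \prod_i ball_weight D t x i]]].
Proof.
have C0p := C0_gt0 bb.
have [F FP] := choice node_exceptional.
have exG Z : exists G : set (set X), ball Z -> [/\ G `<=` ball,
    (\esum_(A in G) mu A <= 2%:E * mu (F Z))%E,
    mu.-negligible (F Z `\` \bigcup_(A in G) star A) &
    forall A D, G A -> ball D -> A `<=` D -> 2 * sz A < sz D ->
      (2%:E * mu (D `&` F Z) <= mu D)%E].
  have [bZ|nbZ] := pselect (ball Z); last by exists set0.
  have [mF muF _] := FP Z bZ.
  have Foo : (mu (F Z) < +oo)%E.
    by apply: le_lt_trans muF _; rewrite (ball_muE bb bZ) -EFinM ltry.
  by have [G GP] := stopping_balls bb mF Foo; exists G.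
have [G GP] := choice exG.
pose ch Z := [set A | [/\ G Z A, ball Z & star A `&` star (star Z) !=set0]].
have nd0 : 0 <= node_density.
  by rewrite invr_ge0 mulr_ge0// exprn_ge0// ltW.
have chb Z : ball Z -> ch Z `<=` ball.
  by move=> bZ A [GA _ _]; have [+ _ _ _] := GP Z bZ; exact.
have chmu Z : ball Z ->
    (\esum_(A in ch Z) mu A <= (48 * C0 ^+ 11)^-1%:E * mu Z)%E.
  move=> bZ; have [_ Gmu _ _] := GP Z bZ; have [_ muF _] := FP Z bZ.
  apply: le_trans (_ : (_ <= \esum_(A in G Z) mu A)%E) _.
    by apply: esum_subset => // A [].
  apply: le_trans Gmu _; apply: le_trans (lee_wpmul2l _ muF) _ => //.
  rewrite muleA -EFinM; apply: lee_wpmul2r => //; rewrite lee_fin le_eqVlt.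
  by apply/orP; left; apply/eqP; rewrite /node_density; field; rewrite gt_eqF.
have chsz Z A : ball Z -> ch Z A -> sz A <= (48 * C0 ^+ 11)^-1 * sz Z.
  move=> bZ chA; have bA := chb Z bZ _ chA.
  rewrite -lee_fin EFinM -(ball_muE bb bZ) -(ball_muE bb bA).
  by apply: le_trans (chmu _ bZ); exact: (@esum_ge_term _ _ _ A (fun A => mu A)).
(* triple stars of nodes are used so that they remain nested along chains:
   the third star absorbs what sticks out of the second *)
have nested Z Y x : ball Z -> ball Y -> star3 Y x -> star (star Z) x ->
    2 * C0 ^+ 3 * sz Y <= sz Z -> star3 Y `<=` star3 Z.
  move=> bZ bY Yx Zx YZ; have b3 := iter_star_ball bb 3 bY.
  have b2 := iter_star_ball bb 2 bZ.
  apply: (star_swallow bb b3 b2); first by exists x.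
  have h1 := iter_star_size bb 3 bY.
  have h2 := ball_size_le bb bZ b2 (sub_iter_star bb 2 bZ).
  have h3 := ball_size_gt0 bb bZ.
  by apply: le_trans h1 _; move: h2 h3 YZ => /=; lra.
have C0n1 n : 1 <= C0 ^+ n by apply: exprn_ege1; exact: ball_C0_ge1 bb.
have ch3 Z A : ball Z -> ch Z A -> star3 A `<=` star3 Z.
  move=> bZ chA; have bA := chb Z bZ _ chA; have [_ _ [x [Ax Zx]]] := chA.
  apply: (nested Z A x) => //.
    exact: (sub_iter_star bb 2 (star_ball bb bA)).
  have h := chsz Z A bZ chA; apply: le_trans (ler_wpM2l _ h) _.
    by rewrite mulr_ge0// exprn_ge0// ltW.
  have sZ := ball_size_gt0 bb bZ.
  rewrite mulrA ler_piMl ?(ltW sZ)// ler_pdivrMr ?mulr_gt0 ?exprn_gt0// mul1r.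
  have := C0n1 3%N; have := C0n1 8%N; have -> : C0 ^+ 11 = C0 ^+ 3 * C0 ^+ 8 by ring.
  by move=> h8 h3; nra.
have [S [lv [[Sb SQ SleQ] Sch S_level Soo S_carl]]] :=
  sparse_selection bb bQ chb chmu ch3.
exists S, lv; split=> //.
pose N1 := [set x | forall n, exists Y, [/\ S Y, (n <= lv Y)%N & iter 2 star Y x]].
have negN1 : mu.-negligible N1 by exact: (ae_bounded_levels bb lv Sb Soo 2).
pose N2 := \bigcup_(Z in S) (F Z `\` \bigcup_(A in G Z) star A).
have negN2 : mu.-negligible N2.
  apply: negligible_countable_bigcup.
    exact: (countable_summable_balls bb Sb Soo).
  by move=> Z SZ; have [_ _ + _] := GP Z (Sb _ SZ).
apply: negligibleS (negligibleU negN1 negN2) => x [Qx nol].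
apply: contrapT => nN; apply: nol.
have nN1 : ~ N1 x by move=> ?; apply: nN; left.
have nN2 : ~ N2 x by move=> ?; apply: nN; right.
have [n Hn] : exists n, forall Y, S Y -> star (star Y) x -> (lv Y < n)%N.
  apply: contrapT => H; apply: nN1 => n; apply: contrapT => H'; apply: H.
  exists n => Y SY Yx; rewrite ltnNge; apply/negP => nY; apply: H'.
  by exists Y.
have main k Z : S Z -> star (star Z) x -> (n <= lv Z + k)%N ->
  exists l : seq (set X), [/\ uniq l,
     forall D, D \in l -> [/\ D x, D `<=` star3 Z & exists2 Y, S Y & D = star3 Y] &
     forall t : {set 'I_m}, t \subset tau ->
       `|T (vindic (commutator_arg b (fun i => i \in t) f x) (node_domain Z)) x|
         <= step_const * CT * \sum_(D <- l) \prod_i ball_weight D t x i].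
  elim: k Z => [|k ih] Z SZ Zx nZ.
    by have := Hn Z SZ Zx; rewrite ltnNge -[lv Z]addn0 nZ.
  have bZ := Sb _ SZ; have [mF muF good] := FP Z bZ.
  have mH := node_domain_measurable bZ.
  have Z3x : star3 Z x by exact: (sub_star bb (iter_star_ball bb 2 bZ)).
  have [Fx|nFx] := pselect (F Z x); last first.
    exists [:: star3 Z]; split=> //.
      by move=> D; rewrite inE => /eqP ->; split=> //; exists Z.
    move=> t tt; rewrite big_seq1.
    by apply: (stop_bound mH good) => // i; exact: avg_ge0.
  have [_ _ _ GD] := GP Z bZ.
  have [A GA Ax] : exists2 A, G Z A & star A x.
    by apply: contrapT => H; apply: nN2; exists Z.
  have chA : ch Z A by split=> //; exists x.
  have bA := chb Z bZ A chA.
  have [Y [SY AY lvY YZ]] := Sch Z A SZ chA.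
  have bY := Sb _ SY; have sY := ball_size_gt0 bb bY.
  have bsY := star_ball bb bY; have bssY := star_ball bb bsY.
  have AYY : star A `<=` star (star Y) by exact: (star_mono bb bA bsY AY).
  have Yx : star (star Y) x by exact: AYY.
  have Y3x : star3 Y x by exact: (sub_star bb bssY).
  have Y3Z3 : star3 Y `<=` star3 Z by exact: (nested Z Y x).
  have YZsz : 2 * sz (star3 Y) <= sz Z.
    by apply: le_trans YZ; rewrite -mulrA ler_pM2l//; exact: (iter_star_size bb).
  have YQ : Y != Q.
    apply/eqP => YQ; have := SleQ Z SZ; rewrite -YQ.
    have := ball_size_le bb bY (iter_star_ball bb 3 bY) (sub_iter_star bb 3 bY).
    by lra.
  have HY : node_domain Y = star3 Y by rewrite /node_domain (negbTE YQ).
  have YH : star (star (star Y)) `<=` node_domain Z.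
    by rewrite /node_domain; case: ifP.
  have nondense B : ball B -> star (star Y) `<` B ->
      (2%:E * mu (B `&` F Z) <= mu B)%E.
    move=> bB [YB nBY].
    have AB : A `<=` B.
      apply: subset_trans YB; apply: subset_trans AYY; exact: (sub_star bb).
    apply: (GD A B GA bB AB); rewrite ltNge; apply/negP => BA; apply: nBY.
    (* otherwise B would lie in star A, inside the double star of Y *)
    apply: subset_trans AYY; apply: (star_swallow bb bB bA) => //.
    by have [y Ay] := ball_nonempty bb bA; exists y; split=> //; exact: AB.
  have nY : (n <= lv Y + k)%N.
    by apply: leq_trans nZ _; rewrite addnS -addSn leq_add2r ltnW.
  have [l [ul lP lT]] := ih Y SY Yx nY.
  exists (star3 Z :: l); split.
  - rewrite /= ul andbT; apply/negP => /lP[_ Z3Y3 _].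
    have b3Y := iter_star_ball bb 3 bY; have b3Z := iter_star_ball bb 3 bZ.
    have h1 := ball_size_le bb b3Z b3Y Z3Y3.
    have h2 := ball_size_le bb bZ b3Z (sub_iter_star bb 3 bZ).
    have h3 := ball_size_gt0 bb b3Y.
    by move: h1 h2 h3 YZsz; lra.
  - move=> D; rewrite inE => /orP[/eqP->|/lP[Dx DY SD]].
      by split=> //; exists Z.
    by split=> //; exact: subset_trans Y3Z3.
  - move=> t tt; rewrite big_cons mulrDr.
    have := step_bound mH mF good (fun i => avg_ge0 _ _ _ _)
      (fun i => avg_ge0 _ _ _ _) bssY YH nondense tt Yx.
    move/le_trans; apply; apply: lerD => //.
    by have := lT t tt; rewrite HY.
have [l [ul lP lT]] := main n Q SQ (sub_iter_star bb 2 bQ Qx) (leq_addl _ _).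
exists l; split=> //.
  by move=> D /lP[Dx _ SD].
move=> t tt; have := lT t tt; rewrite /node_domain eqxx.
congr (`|T _ x| <= _); apply/funext => i; apply/funext => y.
by rewrite /vindic /= indicT mulr1.
Qed.

Local Notation weight_op S t x :=
  (\esum_(D in S) ((\prod_i ball_weight D t x i)%:E * (\1_D x)%:E))%E.

Lemma sparse_domination : exists S1 S2 : set (set X),
  [/\ sparse mu ball (2 * C0 ^+ 3)^-1 S1, sparse mu ball (2 * C0 ^+ 3)^-1 S2 &
  {ae mu, forall x, Q x -> forall t : {set 'I_m}, t \subset tau ->
    (`|T (commutator_arg b (fun i => i \in t) f x) x|%:E
      <= (step_const * CT)%:E * (weight_op S1 t x + weight_op S2 t x))%E}].
Proof.
have [S [lv [Sb S_level Soo S_carl neg]]] := chain_domination.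
pose SP (p : bool) := [set D | exists2 Y, S Y & odd (lv Y) = p /\ D = star3 Y].
have spP p : sparse mu ball (2 * C0 ^+ 3)^-1 (SP p).
  exact: (sparse_parity bb Sb Soo S_level S_carl).
exists (SP true), (SP false); split=> //.
apply: negligibleS neg => x /= nx.
apply: contrapT => nQ; apply: nx => Qx t tt; apply: contrapT => nle; apply: nQ.
split=> // -[l [ul lP lT]]; apply: nle.
apply: le_trans (_ : ((step_const * CT * \sum_(D <- l) \prod_i ball_weight D t x i)%:E
  <= _)%E); first by rewrite lee_fin; exact: lT.
rewrite EFinM; apply: lee_wpmul2l.
  by rewrite lee_fin mulr_ge0 ?(ltW step_const_gt0) ?(ltW CT_gt0).
pose phi D := ((\prod_i ball_weight D t x i)%:E * (\1_D x)%:E)%E.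
have phi0 D : (0 <= phi D)%E.
  rewrite /phi -EFinM lee_fin mulr_ge0//.
  by apply: prodr_ge0 => i _; exact: ball_weight_ge0.
apply: le_trans (esumU_le (SP true) (SP false) phi0).
apply: le_trans (_ : (_ <= \sum_(D <- l) phi D)%E) _; last first.
  apply: esum_ge_seq => // D /lP[_ [Y SY DY]].
  by case: (boolP (odd (lv Y))) => pY; [left|right]; exists Y => //; rewrite ?(negbTE pY).
rewrite -sumEFin big_seq [leRHS]big_seq; apply: lee_sum => D /lP[Dx _].
by rewrite /phi indicE mem_set// mule1.
Qed.

(** Expansion of the product over [t0]: [t.1] and [t.2] are the sets of indices
    at which the first, respectively the second, summand is taken. *)
Lemma sum_split_prod (I : finType) (t0 : {set I}) (A B U : I -> R) :
  \prod_i (if i \in t0 then A i + B i else U i) =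
  \sum_(t : {set I} * {set I} | [disjoint t.1 & t.2] && (t.1 :|: t.2 == t0)%SET)
    (\prod_(i in t.1) A i * \prod_(i in t.2) B i *
     \prod_(i in (~: (t.1 :|: t.2))%SET) U i).
Proof.
have JU (J : {set I}) : J \subset t0 -> (J :|: (t0 :\: J))%SET = t0.
  move=> Jt0; apply/setP => i; rewrite !inE; case: (boolP (i \in J)) => //= iJ.
  by rewrite (fintype.subsetP Jt0).
pose F i := if i \in t0 then A i else 0.
pose G i := if i \in t0 then B i else U i.
transitivity (\prod_i (F i + G i)).
  by apply: eq_bigr => i _; rewrite /F /G; case: ifP => // _; rewrite add0r.
rewrite bigA_distr (bigID (fun J : {set I} => J \subset t0))/= [X in _ + X]big1 ?addr0.
  rewrite [RHS](reindex_onto (fun J : {set I} => (J, t0 :\: J)%SET) fst)/=; last first.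
    move=> [t1 t2] /= /andP[dis /eqP t12]; congr pair.
    rewrite -t12 finset.setDUl finset.setDv finset.set0U.
    apply/finset.setDidPl; by rewrite disjoint_sym.
  apply: eq_big => J.
    rewrite eqxx andbT; apply/idP/andP => [Jt0|[_ /eqP<-]]; last exact: finset.subsetUl.
    rewrite (JU _ Jt0); split=> //.
    by rewrite finset.disjoints_subset finset.setCD finset.subsetUr.
  move=> Jt0; rewrite (JU _ Jt0) (bigID (fun i => i \in J))/=; rewrite -mulrA; congr (_ * _).
    apply: eq_bigr => i iJ; rewrite iJ /F (fintype.subsetP Jt0)//.
  rewrite (bigID (fun i => i \in t0))/=; congr (_ * _).
    apply: eq_big => i; first by rewrite !inE.
    by move=> /andP[/negbTE iJ it0]; rewrite iJ /G it0.
  apply: eq_big => i.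
    rewrite !inE; case: (boolP (i \in t0)) => //= it0; rewrite ?andbF// andbT.
    by apply: contra it0; exact: (fintype.subsetP Jt0).
  by move=> /andP[/negbTE iJ /negbTE it0]; rewrite iJ /G it0.
move=> J /fintype.subsetPn[i iJ it0]; rewrite (bigD1 i)//= iJ /F (negbTE it0).
by rewrite mul0r.
Qed.

Lemma eq_avg_r D (g h : X -> R) : (forall x, `|g x| = `|h x|) ->
  avg_r mu r D g = avg_r mu r D h.
Proof. by move=> gh; rewrite /avg_r; under eq_integral do rewrite gh. Qed.

Lemma sum_sparse_comm_op (S : set (set X)) x : S `<=` ball ->
  (\sum_(t : {set 'I_m} * {set 'I_m}
          | [disjoint t.1 & t.2] && (t.1 :|: t.2 == tau)%SET)
     sparse_comm_op mu r b t.1 t.2 S f x = weight_op S tau x)%E.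
Proof.
move=> Sb; rewrite /sparse_comm_op -esum_sum; last first.
  move=> D t SD _; rewrite !mule_ge0//.
  - by apply: prode_ge0 => i _; rewrite mule_ge0 ?lee_fin// poweR_ge0.
  - by apply: prode_ge0 => i _; exact: poweR_ge0.
  - by apply: prode_ge0 => i _; exact: poweR_ge0.
apply: eq_esum => D SD; have bD := Sb _ SD.
have mD := ball_measurable bb bD; have sD := ball_size_gt0 bb bD.
have avgf i : avg_r mu r D (f i) = (avg D (f i))%:E.
  by have [] := avgE r_ge1 mD sD (fL i).
pose V i := avg D (oscil (center D) i).
have avgo i : i \in tau ->
    avg_r mu r D (fun y => (b i y - mean mu D (b i)) * f i y) = (V i)%:E.
  move=> it; have [<- _] := avgE r_ge1 mD sD (oscil_Lfun (center D) it).
  by apply: eq_avg_r => y; rewrite /oscil !normrM distrC.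
rewrite /ball_weight /weight sum_split_prod -sumEFin ge0_sume_distrl; last first.
  move=> t _; rewrite lee_fin !mulr_ge0//; apply: prodr_ge0 => i _ //.
  - by rewrite mulr_ge0// avg_ge0.
  - exact: avg_ge0.
  - exact: avg_ge0.
apply: eq_bigr => t /andP[_ /eqP t12]; congr (_ * _)%E.
have e1 : (\prod_(i in t.1) (`|b i x - mean mu D (b i)|%:E * avg_r mu r D (f i)) =
    (\prod_(i in t.1) (`|b i x - center D i| * avg D (f i)))%:E)%E.
  by rewrite -prodEFin; apply: eq_bigr => i _; rewrite avgf.
have e2 : (\prod_(j in t.2) avg_r mu r D (fun y => (b j y - mean mu D (b j)) * f j y)%R =
    (\prod_(i in t.2) V i)%:E)%E.
  rewrite -prodEFin; apply: eq_bigr => i it; apply: avgo.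
  by rewrite -t12 finset.in_setU it orbT.
have e3 : (\prod_(k in ~: (t.1 :|: t.2)) avg_r mu r D (f k) =
    (\prod_(i in (~: (t.1 :|: t.2))%SET) avg D (f i))%:E)%E.
  by rewrite -prodEFin; apply: eq_bigr => i _; rewrite avgf.
by rewrite !EFinM; exact: (congr2 mule (congr2 mule e1 e2) e3).
Qed.

Lemma sparse_op_weight (S : set (set X)) x : S `<=` ball ->
  sparse_op mu r S f x = weight_op S finset.set0 x.
Proof.
move=> Sb; apply: eq_esum => D SD; have bD := Sb _ SD; congr (_ * _)%E.
rewrite -prodEFin; apply: eq_bigr => i _.
rewrite /ball_weight /weight finset.in_set0.
by have [] := avgE r_ge1 (ball_measurable bb bD) (ball_size_gt0 bb bD) (fL i).
Qed.

End step.
(** * Operator norm and commutators *)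

Section operator_norm.
Context d (X : measurableType d) (R : realType) (m : nat).
Context (mu : {measure set X -> \bar R}) (r : R) (T : ('I_m -> X -> R) -> X -> R).

Lemma weak_bound_le (c c' : R) : c <= c' -> weak_bound mu r T c -> weak_bound mu r T c'.
Proof.
move=> cc' [c0 wc]; split; first exact: le_trans cc'.
move=> f fL; apply: le_trans (wc f fL) _; apply: lee_wpmul2r; last by rewrite lee_fin.
by apply: prode_ge0 => i _; exact: Lnorm_ge0.
Qed.

(** The infimum defining the norm need not be attained a priori, but any
    larger number is a bound. *)
Lemma weak_bound_opnorm (e : R) : 0 < e -> weak_bounded mu r T ->
  0 <= weak_opnorm mu r T /\ weak_bound mu r T (weak_opnorm mu r T + e).
Proof.
move=> e0 [_ [c wc]].
have hinf : has_inf [set c | weak_bound mu r T c].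
  by split; [exists c|exists 0 => c' []].
split; first by apply: lb_le_inf; [exists c|move=> c' []].
have [c' wc' c'lt] := inf_adherent e0 hinf.
by apply: weak_bound_le wc'; exact: ltW.
Qed.

End operator_norm.

Lemma comm_arg_full d (X : measurableType d) (R : realType) (m : nat)
    (b f : 'I_m -> X -> R) (alpha : 'I_m -> bool) :
  commutator_arg b (fun i => i \in [set i | alpha i]%SET) f = commutator_arg b alpha f.
Proof.
apply/funext => x; apply/funext => i; apply/funext => y.
by rewrite /commutator_arg inE.
Qed.

Lemma comm_arg_empty d (X : measurableType d) (R : realType) (m : nat)
    (b f : 'I_m -> X -> R) x :
  commutator_arg b (fun i => i \in finset.set0) f x = f.
Proof.
apply/funext => i; apply/funext => y.
by rewrite /commutator_arg finset.in_set0 expr0 mul1r.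
Qed.

(** Whether the commutator makes sense does not depend on the point, since two
    of its arguments differ by multiples of [f]. *)
Lemma commutator_defined_Lfun d (X : measurableType d) (R : realType) (m : nat)
    (mu : {measure set X -> \bar R}) (r : R) (b f : 'I_m -> X -> R)
    (alpha : 'I_m -> bool) x i : 1 <= r -> Lvec mu r f ->
  commutator_defined mu r b alpha f x -> alpha i ->
  (fun y => b i y * f i y) \in Lfun mu r%:E.
Proof.
move=> r1 fL def ai; have := def i.
have -> : commutator_arg b alpha f x i = fun y => (b i x - b i y) * f i y.
  by apply/funext => y; rewrite /commutator_arg ai expr1.
move=> gL; have -> : (fun y => b i y * f i y) =
    fun y => b i x * f i y + (-1) * ((b i x - b i y) * f i y).
  by apply/funext => y; ring.
by apply: Lfun_lin => //; exact: Lfun_scale_r.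
Qed.

Theorem theorem1p5 (R : realType) (m : nat) (m_gt0 : (0 < m)%N)
    (r : R) (r_ge1 : 1 <= r) (C0 : R) :
  exists2 C : R, 0 < C &
  forall (d : measure_display) (X : measurableType d)
    (mu : {measure set X -> \bar R}) (ball : set (set X))
    (star : set X -> set X), ball_basis mu ball star C0 ->
  forall (V : completeNormedModType R) (T : ('I_m -> X -> R) -> X -> R)
    (C1 C2 : R), bounded_oscillation mu ball star r T C1 C2 V ->
  weak_bounded mu r T ->
  forall (b : 'I_m -> X -> R) (alpha : 'I_m -> bool),
  (forall i, measurable_fun setT (b i)) ->
  (forall i B, alpha i -> ball B -> mu.-integrable B (EFin \o b i)) ->
  let CT : R := C1 + C2 + weak_opnorm mu r T in
  let tau : {set 'I_m} := [set i | alpha i]%SET in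
  forall (B : set X) (f : 'I_m -> X -> R), ball B ->
  (forall i, f i \in Lfun mu r%:E) ->
  (forall i, (2^-1%:E * \int[mu]_x (`|f i x| `^ r)%:E
              <= \int[mu]_(x in B) (`|f i x| `^ r)%:E)%E) ->
  exists S1 S2 : set (set X),
    [/\ sparse mu ball (2 * C0 ^+ 3)^-1 S1,
        sparse mu ball (2 * C0 ^+ 3)^-1 S2 &
        {ae mu, forall x, B x ->
          (`|T f x|%:E
             <= (C * CT)%:E * (sparse_op mu r S1 f x + sparse_op mu r S2 f x))%E
          /\
          (commutator_defined mu r b alpha f x ->
           (`|commutator T b alpha f x|%:E
             <= (C * CT)%:E *
                \sum_(t : {set 'I_m} * {set 'I_m}
                      | [disjoint t.1 & t.2] && (t.1 :|: t.2 == tau)%SET)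
                  (sparse_comm_op mu r b t.1 t.2 S1 f x
                   + sparse_comm_op mu r b t.1 t.2 S2 f x))%E)}].
Proof.
have [C01|C01] := leP 1 C0; last first.
  exists 1 => // d X mu ball star bb.
  by have := ball_C0_ge1 bb; rewrite leNgt C01.
have [Cp|Cn] := ltP 0 (step_const C0 m); last first.
  exists 1 => // d X mu ball star bb.
  by have := step_const_gt0 bb m_gt0; rewrite ltNge Cn.
exists (step_const C0 m) => // d X mu ball star bb V T C1 C2 bo wbT b alpha _ _ CT tau B f
  bB fL _.
have [C1p C2p subT [W [Tv [nT T1 T2]]]] := bounded_oscillation_model r_ge1 bo.
have [norm0 wT'] := weak_bound_opnorm C1p wbT.
have wT : weak_bound mu r T CT by apply: weak_bound_le wT'; rewrite /CT; lra.
have CT0 : 0 < CT by rewrite /CT; lra.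
have C1T : C1 <= CT by rewrite /CT; lra.
have C2T : C2 <= CT by rewrite /CT; lra.
have [mT _] := wbT.
(* t0 is tau if the commutator is defined, and empty otherwise *)
have dominate (t0 : {set 'I_m}) :
    (forall i, i \in t0 -> (fun y => b i y * f i y) \in Lfun mu r%:E) ->
    exists S1 S2 : set (set X),
    [/\ sparse mu ball (2 * C0 ^+ 3)^-1 S1, sparse mu ball (2 * C0 ^+ 3)^-1 S2 &
    {ae mu, forall x, B x -> forall t : {set 'I_m}, t \subset t0 ->
      (`|T (commutator_arg b (fun i => i \in t) f x) x|%:E
        <= (step_const C0 m * CT)%:E *
         (\esum_(D in S1) ((\prod_i ball_weight mu r b f D t x i)%:E * (\1_D x)%:E) +
          \esum_(D in S2) ((\prod_i ball_weight mu r b f D t x i)%:E * (\1_D x)%:E)))%E}].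
  move=> bfL; have [Q [bQ BQ concf conco]] := root_ball bb r_ge1 bB fL bfL.
  have [S1 [S2 [sp1 sp2 dom]]] := sparse_domination bb r_ge1 m_gt0 CT0 wT mT subT fL bfL
    C1p C2p C1T C2T nT T1 T2 bQ concf (fun i c it => conco i c it).
  exists S1, S2; split=> //.
  by apply: filterS dom => x dom Bx; apply: dom; exact: BQ.
have [bfL|nbfL] := pselect (forall i, i \in tau -> (fun y => b i y * f i y) \in Lfun mu r%:E).
  have [S1 [S2 [sp1 sp2 dom]]] := dominate tau bfL.
  have [S1b _] := sp1; have [S2b _] := sp2.
  exists S1, S2; split=> //; apply: filterS dom => x dom Bx; split.
    have := dom Bx finset.set0 (finset.sub0set _).
    by rewrite comm_arg_empty -!(sparse_op_weight bb r_ge1 b fL).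
  move=> _; have := dom Bx tau (fintype.subxx _).
  rewrite /tau comm_arg_full -/tau => h; apply: le_trans h _.
  rewrite big_split/= !(sum_sparse_comm_op bb r_ge1 fL bfL)//.
have [i|S1 [S2 [sp1 sp2 dom]]] := dominate finset.set0.
  by rewrite finset.in_set0.
have [S1b _] := sp1; have [S2b _] := sp2.
exists S1, S2; split=> //; apply: filterS dom => x dom Bx; split.
  have := dom Bx finset.set0 (finset.sub0set _).
  by rewrite comm_arg_empty -!(sparse_op_weight bb r_ge1 b fL).
move=> def; exfalso; apply: nbfL => i; rewrite inE => ai.
exact: (commutator_defined_Lfun r_ge1 fL def ai).
Qed.
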